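(* Consider the regression model, the confidence bands, the Gaussian random field $Z$ and the chi-square random process $Y$ described in the context, and let $\alpha\in(0,1)$. (1) When $\Sigma$ is known, the critical value $b_{1-\alpha}$ (the value $b$ for which the band with known $\Sigma$ covers all contrasts simultaneously with probability $1-\alpha$) is determined as the solution $b=b_{1-\alpha}$ of $$\Pr\Bigl(\max_{x\in\mathcal{X},\,h\in\mathbb{S}^{k-2}} Z(x,h)\ge b\Bigr)=\Pr\Bigl(\max_{x\in\mathcal{X}}Y(x)\ge b^2\Bigr)=\alpha .$$ (2) When $\Sigma=\sigma^2\Sigma_0$ with $\Sigma_0$ known and $\sigma^2$ unknown, and the band uses $\widehat\sigma^2\Sigma_0$ in place of $\Sigma$, the critical value $b_{1-\alpha}$ is determined as the solution $b=b_{1-\alpha}$ of $$\mathrm{E}\Bigl[\Pr\Bigl(\max_{x\in\mathcal{X},\,h\in\mathbb{S}^{k-2}} Z(x,h)\ge b\tau \,\Big|\, \tau^2\Bigr)\Bigr]=\mathrm{E}\Bigl[\Pr\Bigl(\max_{x\in\mathcal{X}}Y(x)\ge b^2\tau^2\,\Big|\,\tau^2\Bigr)\Bigr]=\alpha ,$$ where the expectation is taken over $\tau^2\sim\chi^2_\nu/\nu$ (independent of $Z$ and $Y$), with $\nu$ the degrees of freedom of the estimator $\widehat\sigma^2$ of $\sigma^2$.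
   Context: Let $k\ge 3$, let $\mathcal{X}\subseteq\mathbb{R}$ be an interval (finite, half-infinite, or all of $\mathbb{R}$) or a finite union of intervals, and let $f=(f_1,\dots,f_p)^\top:\mathcal{X}\to\mathbb{R}^p$ be a known basis vector function, with $f(x)\neq 0$. Observations are $y_{ijh}=\beta_i^\top f(x_j)+\varepsilon_{ijh}$, $i=1,\dots,k$, $j=1,\dots,n$, $h=1,\dots,r_i$, with $x_j\in\mathcal{X}$, unknown $\beta_i\in\mathbb{R}^p$, and independent errors $\varepsilon_{ijh}\sim\mathcal{N}(0,\sigma(x_j)^2)$. The (weighted) least squares estimators $\widehat\beta_i$ are independent with $\widehat\beta_i\sim\mathcal{N}_p(\beta_i,r_i^{-1}\Sigma)$, where $$\Sigma=\Bigl(\sum_{j=1}^n \sigma(x_j)^{-2}f(x_j)f(x_j)^\top\Bigr)^{-1}$$ (assumed to exist). Either $\sigma(x)^2$ is known, or $\sigma(x)^2=\sigma^2\sigma_0(x)^2$ with $\sigma_0$ known and $\sigma^2$ unknown; in the latter case $\Sigma=\sigma^2\Sigma_0$, where $\Sigma_0$ is $\Sigma$ with $\sigma(x_j)$ replaced by $\sigma_0(x_j)$, and an estimator $\widehat\sigma^2\sim\sigma^2\chi^2_\nu/\nu$ independent of the $\widehat\beta_i$ is available; $\tau^2=\widehat\sigma^2/\sigma^2$, $\tau>0$. Let $\mathcal{C}$ be the set of (nonzero) vectors $c=(c_1,\dots,c_k)^\top\in\mathbb{R}^k$ with $\sum_{i=1}^k c_i=0$. The simultaneous confidence band with critical value $b$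 consists of the statements $$\Bigl|\sum_{i=1}^k c_i\widehat\beta_i^\top f(x)-\sum_{i=1}^k c_i\beta_i^\top f(x)\Bigr|\le b\sqrt{\Bigl(\sum_{i=1}^k \tfrac{c_i^2}{r_i}\Bigr)f(x)^\top\Sigma f(x)}\quad\text{for all }x\in\mathcal{X},\ c\in\mathcal{C},$$ with $\Sigma$ replaced by $\widehat\sigma^2\Sigma_0$ when $\sigma^2$ is unknown. The critical value $b_{1-\alpha}$ is the value of $b$ for which the probability that all these statements hold simultaneously equals $1-\alpha$. Let $\Sigma^{1/2}$ be a matrix with $(\Sigma^{1/2})^\top\Sigma^{1/2}=\Sigma$, and $\psi(x)=\Sigma^{1/2}f(x)/\|\Sigma^{1/2}f(x)\|$, a unit vector in $\mathbb{R}^p$. $\mathbb{S}^{m-1}$ is the unit sphere of $\mathbb{R}^m$. Let $\xi_1,\dots,\xi_{k-1}$ be i.i.d. $\mathcal{N}_p(0,I)$ and $\xi=(\xi_1^\top,\dots,\xi_{k-1}^\top)^\top\in\mathbb{R}^{p(k-1)}$. Define $$Z(x,h)=\xi^\top\{h\otimes\psi(x)\},\ (x,h)\in\mathcal{X}\times\mathbb{S}^{k-2};\qquad Y(x)=\sum_{i=1}^{k-1}\{\xi_i^\top\psi(x)\}^2,\ x\in\mathcal{X},$$ where $\otimes$ is the Kronecker product. Maxima are understood as suprema where not attained. *)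

(* Defs.v *)
From HB Require Import structures.
From mathcomp Require Import all_boot all_order all_algebra.
From mathcomp Require Import mxtens.
From mathcomp Require Import all_classical all_reals all_analysis.

Set Implicit Arguments.
Unset Strict Implicit.
Unset Printing Implicit Defensive.

Import Order.TTheory GRing.Theory Num.Theory.
Import numFieldNormedType.Exports.

Local Open Scope classical_set_scope.
Local Open Scope ring_scope.

Section probability_notions.
Context d (Omega : measurableType d) (R : realType) (P : probability Omega R).

(* Equality of laws is only required on Borel sets: [normal_prob] and
   [chi2_prob] are integrals, hence meaningless on nonmeasurable sets. *)
Definition has_law (W : Omega -> R) (mu : set R -> \bar R) : Prop :=
  forall B : set R, measurable B -> P (W @^-1` B) = mu B.

Definition sigma_rv (W : Omega -> R) : set (set Omega) :=
  preimage_set_system setT W measurable.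

Definition sigma_family (I : Type) (D : set I) (W : I -> Omega -> R) :
    set (set Omega) :=
  <<s \bigcup_(i in D) sigma_rv (W i) >>.

(* Taking [A i = setT] off a subfamily, which is possible when every [F i] is
   a sigma-algebra, recovers the product rule for all subfamilies. *)
Definition mutually_independent (I : finType) (F : I -> set (set Omega)) :
    Prop :=
  forall A : I -> set Omega, (forall i, F i (A i)) ->
  P (\bigcap_i A i) = (\prod_(i : I) P (A i))%E.

Definition independent (F G : set (set Omega)) : Prop :=
  forall A B : set Omega, F A -> G B -> P (A `&` B) = (P A * P B)%E.

Definition std_normal_vector (q : nat) (W : 'I_q -> {RV P >-> R}) : Prop :=
  mutually_independent (fun l => sigma_rv (W l)) /\
  (forall l, has_law (W l) (normal_prob 0 1)).

Definition iid_std_normal_vectors (m q : nat)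
    (xi : 'I_m -> 'I_q -> {RV P >-> R}) : Prop :=
  mutually_independent
    (fun i => sigma_family setT (fun l => xi i l : Omega -> R)) /\
  (forall i, std_normal_vector (xi i)).

(* [g] is a version of the conditional probability of [A] given the
   sigma-algebra [G]. *)
Definition is_cond_prob (G : set (set Omega)) (A : set Omega)
    (g : Omega -> R) : Prop :=
  [/\ forall B : set R, measurable B -> G (g @^-1` B),
      P.-integrable setT (EFin \o g) &
      forall C, G C -> (\int[P]_(w in C) (g w)%:E)%E = P (A `&` C)].

(* Pr(A | T): a version chosen by classical choice; versions agree P-a.e. *)
Definition cond_prob (A : set Omega) (T : Omega -> R) : Omega -> R :=
  xget (fun=> 0) [set g | is_cond_prob (sigma_rv T) A g].

End probability_notions.

Section chi_square.
Context (R : realType).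
Implicit Types (nu : nat) (a t : R).

Definition Gamma a : R :=
  fine (\int[lebesgue_measure]_(t in `]0%R, +oo[)
          (t `^ (a - 1) * expR (- t))%:E)%E.

Definition chi2_pdf nu t : R :=
  if 0 < t then
    t `^ (nu%:R / 2 - 1) * expR (- t / 2)
      / (2 `^ (nu%:R / 2) * Gamma (nu%:R / 2))
  else 0.

Definition chi2_prob nu (B : set R) : \bar R :=
  (\int[lebesgue_measure]_(t in B) (chi2_pdf nu t)%:E)%E.

End chi_square.

Section regression.
Context (R : realType).

Definition finite_union_itv (X : set R) : Prop :=
  exists s : seq (interval R), X = \bigcup_(I in [set` s]) [set` I].

Definition dot m (u v : 'cV[R]_m) : R := (u^T *m v) 0 0.

(* The library norm on matrices is the max norm, hence a separate definition. *)
Definition l2norm m (u : 'cV[R]_m) : R := Num.sqrt (dot u u).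

Definition unit_sphere m : set 'cV[R]_m := [set h | l2norm h = 1].

Definition quad_form m (V : 'M[R]_m) (u : 'cV[R]_m) : R :=
  (u^T *m V *m u) 0 0.

Section model.
Context (k p n : nat) (r : 'I_k -> nat) (X : set R) (f : R -> 'cV[R]_p)
  (x : 'I_n -> R) (beta : 'I_k -> 'cV[R]_p).

Definition information (sd : R -> R) : 'M[R]_p :=
  \sum_(j < n) sd (x j) ^- 2 *: (f (x j) *m (f (x j))^T).

Definition Sigma (sd : R -> R) : 'M[R]_p := invmx (information sd).

Definition obs_index : finType := {i : 'I_k & ('I_n * 'I_(r i))%type}.

Definition obs_idx (i : 'I_k) (j : 'I_n) (h : 'I_(r i)) : obs_index :=
  Tagged (fun i => ('I_n * 'I_(r i))%type) (j, h).

Definition is_wls (sd : R -> R) (m : nat) (y : 'I_n -> 'I_m -> R)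
    (b : 'cV[R]_p) : Prop :=
  let wss (b' : 'cV[R]_p) := \sum_(j < n) \sum_(h < m)
    sd (x j) ^- 2 * (y j h - dot b' (f (x j))) ^+ 2 in
  forall b', wss b <= wss b'.

(* [sd] is the error standard deviation function, [wsd] the one that enters
   the least squares weights; the two may differ by an unknown factor. *)
Definition regression_model (sd wsd : R -> R)
    d (Omega : measurableType d) (P : probability Omega R)
    (eps : obs_index -> {RV P >-> R}) (betahat : 'I_k -> Omega -> 'cV[R]_p) :
    Prop :=
  [/\ mutually_independent P (fun a => sigma_rv (eps a)),
      forall i j h,
        has_law P (eps (@obs_idx i j h)) (normal_prob 0 (sd (x j))) &
      forall i w,
        is_wls wsd
          (fun j h => dot (beta i) (f (x j)) + eps (@obs_idx i j h) w)
          (betahat i w)].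

Definition contrasts : set 'cV[R]_k :=
  [set c | c != 0 /\ \sum_(i < k) c i 0 = 0].

Definition in_band (bhat : 'I_k -> 'cV[R]_p) (V : 'M[R]_p) (b : R) : Prop :=
  forall t c, X t -> contrasts c ->
  `| \sum_(i < k) c i 0 * dot (bhat i) (f t)
     - \sum_(i < k) c i 0 * dot (beta i) (f t) |
  <= b * Num.sqrt ((\sum_(i < k) c i 0 ^+ 2 / (r i)%:R) * quad_form V (f t)).

(* [Vhat] is constant when Sigma is known, random when it is estimated. *)
Definition coverage d (Omega : measurableType d) (P : probability Omega R)
    (betahat : 'I_k -> Omega -> 'cV[R]_p) (Vhat : Omega -> 'M[R]_p) (b : R) :
    \bar R :=
  P [set w | in_band (fun i => betahat i w) (Vhat w) b].

End model.

Definition is_critical_value (cover : R -> \bar R) (alpha b : R) : Prop :=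
  cover b = (1 - alpha)%:E.

Section field.
Context (m p : nat) (X : set R) (f : R -> 'cV[R]_p) (S : 'M[R]_p).

Definition psi (t : R) : 'cV[R]_p := (l2norm (S *m f t))^-1 *: (S *m f t).

Context (Omega : Type) (xi : 'I_m -> 'I_p -> Omega -> R).

Definition xi_vec (i : 'I_m) (w : Omega) : 'cV[R]_p := \col_l xi i l w.

(* The i-th block of size p is [xi_vec i], matching the Kronecker indexing. *)
Definition xi_stack (w : Omega) : 'cV[R]_(m * p) :=
  \col_a xi_vec (mxtens_unindex a).1 w (mxtens_unindex a).2 0.

Definition Zfield (t : R) (h : 'cV[R]_m) (w : Omega) : R :=
  dot (xi_stack w) (tensmx h (psi t) : 'cV[R]_(m * p)).

Definition Yproc (t : R) (w : Omega) : R :=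
  \sum_(i < m) dot (xi_vec i w) (psi t) ^+ 2.

Definition maxZ (w : Omega) : \bar R :=
  ereal_sup [set (Zfield t h w)%:E | t in X & h in @unit_sphere m].

Definition maxY (w : Omega) : \bar R :=
  ereal_sup [set (Yproc t w)%:E | t in X].

End field.

End regression.

(* Main.v *)
Require Import Defs.
From HB Require Import structures.
From mathcomp Require Import all_boot all_order all_algebra.
From mathcomp Require Import mxtens ring lra.
From mathcomp Require Import all_classical all_reals all_analysis.
From mathcomp Require Import measurable_realfun.
Set Implicit Arguments.
Unset Strict Implicit.
Unset Printing Implicit Defensive.
Import Order.TTheory GRing.Theory Num.Theory.
Import numFieldNormedType.Exports.
Local Open Scope classical_set_scope.
Local Open Scope ring_scope.

(** Normalizing the weighted least squares errors by [S^-T] and taking an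
    orthonormal basis of the contrasts (for the weights [1 / r i]) turns the band
    into [N G <= b * sqrt s2], where [N] is the support function of the vectors
    [h (x) psi t] and [G] is a linear image [L eps] of the errors with
    [L D L^T = 1], [D] being the error covariance; moreover [maxZ = N xi] and, by
    Cauchy-Schwarz, [maxY = (N xi)^2].  So everything reduces to [N G] and [N xi]
    having the same law, and to that law having no atom and charging every
    interval of the positive half-line.

    The law of [L eps] is identified through the Cameron-Martin shift formula,
    which passes to linear images and characterizes the standard Gaussian law.
    The same two facts show that [P (N xi \in B) = 0] implies
    [P (N xi \in c * B) = 0] for [c >= 1]; since a law has countably many atoms,
    this excludes atoms, and it excludes gaps in the support.  When sigma is
    unknown, the law of [N xi] is replaced by that of [N xi / sqrt tau2]. *)

(** The estimators enter only as minimizers, with no measurability assumed, and the supremum over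
    [X] may be uncountable. The normal equations settle the first point by writing the standardized
    error as an explicit linear image of [eps]; finite dimension settles the second, since the
    support function is a seminorm on a finite product of lines. Normalizing by [S^-T] makes the
    norm of [S f(t)] a common factor of both sides of the band inequality, and an orthonormal basis
    of contrasts does the same for the norm of the coefficients [h], so that only unit vectors
    remain. The shift formula stands in for Fourier transforms and changes of variables: it passes
    to a linear image as soon as some [v] satisfies [L v = a], and [L D L^T = 1] provides
    [v = D L^T a]. The two properties of the limiting law have separate uses: without atoms the
    distribution function is continuous, so a critical value exists; charging intervals makes it
    strictly increasing, so the value is unique. *)

(** * Densities and translations of one-dimensional Gaussian laws *)

Lemma ge0_integral_density d (T : measurableType d) (R : realType)
    (mu : {sigma_finite_measure set T -> \bar R})
    (nu : {finite_measure set T -> \bar R}) (g f : T -> \bar R) :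
  mu.-integrable setT g ->
  (forall A, measurable A -> nu A = \int[mu]_(x in A) g x)%E ->
  measurable_fun setT f -> (forall x, 0 <= f x)%E ->
  (\int[nu]_x f x = \int[mu]_x (f x * g x))%E.
Proof.
move=> ig nug mf f0.
have dom : nu `<< mu.
  apply/null_content_dominatesP => A mA muA0.
  rewrite nug// (null_set_integral mA _ muA0)//; apply: measurable_funTS.
  exact: measurable_int ig.
rewrite -(Radon_Nikodym_SigmaFinite.change_of_variables dom)//.
apply: ae_eq_integral => //.
- apply: emeasurable_funM => //.
  exact: measurable_int (Radon_Nikodym_SigmaFinite.f_integrable dom).
- by apply: emeasurable_funM => //; exact: measurable_int ig.
apply: ae_eqe_mul2l; apply: integral_ae_eq => //.
- exact: Radon_Nikodym_SigmaFinite.f_integrable.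
- exact: measurable_int ig.
- by move=> A _ mA; rewrite -nug// -Radon_Nikodym_SigmaFinite.f_integral.
Qed.

(** Translation carries Lebesgue measure to a measure with the same values on the intervals []x,
    y]], and these values determine it. *)
Lemma ge0_integral_lebesgue_shift (R : realType) (f : R -> \bar R) (a : R) :
  measurable_fun setT f -> (forall x, 0 <= f x)%E ->
  (\int[@lebesgue_measure R]_x f ((x : R) + a)%R = \int[lebesgue_measure]_x f x)%E.
Proof.
move=> mf f0.
pose phi : measurableTypeR R -> measurableTypeR R := fun x => x + a.
have mphi : measurable_fun setT phi by exact: measurable_funD.
transitivity (\int[pushforward lebesgue_measure phi]_x f x)%E.
  have := ge0_integral_pushforward mphi (@lebesgue_measure R) measurableT mf.
  by rewrite preimage_setT => -> //.
apply: eq_measure_integral => //= A mA _; apply/esym/lebesgue_measure_unique => //=.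
move=> _ [[x y] /= _ <-]; rewrite /pushforward.
have -> : phi @^-1` `]x, y] = `]x - a, y - a]%classic.
  by apply/seteqP; split => z /=; rewrite !in_itv/= ltrBlDr lerBrDr.
rewrite !lebesgue_measure_itv/= !lte_fin ltrD2r.
by case: ifP => // _; rewrite -!EFinB; congr EFin; ring.
Qed.

Lemma integral_normal_prob (R : realType) (m s : R) (f : R -> \bar R) :
  measurable_fun setT f -> (forall x, 0 <= f x)%E ->
  (\int[normal_prob m s]_x f x =
   \int[lebesgue_measure]_x (f x * (normal_pdf m s x)%:E))%E.
Proof. by move=> mf f0; apply: ge0_integral_density => //; exact: integrable_normal_pdf. Qed.

(** The weight is the ratio of the densities of means [a] and [0]: translating the weighted integral
    by [a] turns weight times density at [x + a] into the density at [x]. *)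
Lemma normal_prob_shift (R : realType) (s a : R) (f : R -> \bar R) :
  s != 0 -> measurable_fun setT f -> (forall x, 0 <= f x)%E ->
  (\int[normal_prob 0 s]_x f ((x : R) + a)%R =
   \int[normal_prob 0 s]_x (f x * (expR ((a * (x : R) - a ^+ 2 / 2) / s ^+ 2))%:E))%E.
Proof.
move=> s0 mf f0.
have mD : measurable_fun setT (fun x : R => x + a) by exact: measurable_funD.
have mw : measurable_fun setT
    (fun x : R => (expR ((a * x - a ^+ 2 / 2) / s ^+ 2))%:E).
  apply/measurable_EFinP/measurableT_comp => //; apply: measurable_funM => //.
  by apply: measurable_funB => //; exact: measurable_funM.
rewrite (integral_normal_prob _ _ (measurableT_comp mf mD)); last by move=> x; exact: f0.
rewrite integral_normal_prob; last 2 first.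
- exact: emeasurable_funM.
- by move=> x; rewrite mule_ge0// lee_fin expR_ge0.
rewrite -(ge0_integral_lebesgue_shift (f := fun x => f x * _ * _)%E a); last 2 first.
- apply: emeasurable_funM; first exact: emeasurable_funM.
  by apply/measurable_EFinP; exact: measurable_normal_pdf.
- by move=> x; rewrite !mule_ge0// lee_fin ?expR_ge0// normal_pdf_ge0.
apply: eq_integral => x _; rewrite -muleA -EFinM; congr (_ * _%:E)%E.
rewrite /normal_pdf (negbTE s0) /normal_fun mulrCA -expRD !subr0; congr (_ * expR _).
by field.
Qed.

(** * Gaussian laws on finite products and shifts *)

Section finite_product_space.
Context {R : realType}.
Implicit Types I J : finType.

Definition rectangles I : set (set (I -> R)) :=
  [set [set x | forall i, A i (x i)] |
    A in [set A : I -> set R | forall i, measurable (A i)]].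

(** Coordinates are indexed by an arbitrary finite type because the errors live on the dependent sum
    [obs_index] and the standardized contrasts on pairs; no enumeration has to be chosen. *)
Definition product_space I : Type := g_sigma_algebraType (@rectangles I).

HB.instance Definition _ I := Measurable.on (product_space I).

Lemma measurable_rectangle I (A : I -> set R) : (forall i, measurable (A i)) ->
  measurable ([set x | forall i, A i (x i)] : set (product_space I)).
Proof. by move=> mA; apply: sub_sigma_algebra; exists A. Qed.

Lemma measurable_coord I (i : I) :
  measurable_fun setT (fun x : product_space I => (x i : R)).
Proof.
move=> _ B mB; rewrite setTI.
have -> : (fun x : product_space I => (x i : R)) @^-1` B =
    [set x | forall j, (if j == i then B else setT) (x j)].
  apply/seteqP; split => x /= Bx; last by have := Bx i; rewrite eqxx.
  by move=> j; case: eqP => // ->.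
by apply: (measurable_rectangle (A := fun j => if j == i then B else setT)) => j; case: ifP.
Qed.

Lemma measurable_to_product d (T : measurableType d) I
    (f : T -> product_space I) :
  (forall i, measurable_fun setT (fun t => f t i)) -> measurable_fun setT f.
Proof.
move=> mf; apply: (@measurability _ _ T (product_space I) setT f (@rectangles I) erefl).
move=> _ [_ [A mA <-] <-].
rewrite setTI.
have -> : f @^-1` [set x | forall i, A i (x i)] =
    \bigcap_(i in [set: I]) ((fun t => f t i) @^-1` A i).
  by apply/seteqP; split => t /= h i; [move=> _; exact: h|exact: (h i Logic.I)].
apply: (@fin_bigcap_measurable _ T); first exact: finite_finset.
move=> i _.
by rewrite -[X in measurable X]setTI; exact: mf.
Qed.

Lemma product_law_unique I (mu : probability (product_space I) R)
    (nu : {measure set (product_space I) -> \bar R}) :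
  (forall A : I -> set R, (forall i, measurable (A i)) ->
    mu [set x | forall i, A i (x i)] = nu [set x | forall i, A i (x i)]) ->
  forall B, measurable B -> mu B = nu B.
Proof.
move=> munu B mB.
apply: (@measure_unique _ R (product_space I) (@rectangles I) (fun=> setT) erefl) => //.
- move=> _ _ [A mA <-] [C mC <-]; exists (fun i => A i `&` C i).
    by move=> i; exact: measurableI.
  apply/seteqP; split => x /=; last by move=> [h1 h2] i.
  by move=> h; split=> i; have [] := h i.
- move=> _; exists (fun=> setT) => //.
  by apply/seteqP; split.
- by rewrite bigcup_const.
- by move=> _ [A mA <-]; exact: munu.
- by move=> _; apply: le_lt_trans (ltry 1); exact: probability_le1.
Qed.

(** A property of a given law rather than a constructed product measure: laws arise here as images
    under random vectors, whose independence is this product rule. *)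
Definition gaussian_law I (s : I -> R) (mu : set (product_space I) -> \bar R) :=
  forall A : I -> set R, (forall i, measurable (A i)) ->
  mu [set x | forall i, A i (x i)] = (\prod_i normal_prob 0 (s i) (A i))%E.

Definition replace I (l : I) (p : (product_space I * measurableTypeR R)%type) : product_space I :=
  fun i => if i == l then p.2 else p.1 i.

Lemma measurable_replace I (l : I) : measurable_fun setT (replace l).
Proof.
apply: measurable_to_product => i; rewrite /replace; case: (i == l) => /=.
  exact: measurable_snd.
exact: (measurableT_comp (measurable_coord i) measurable_fst).
Qed.

(* [mu] is the image of [mu \x normal_prob] under the replacement of the
   coordinate [l], which gives access to it by Fubini's theorem. *)
Lemma gaussian_resample I s (mu : probability (product_space I) R) (l : I)
    (f : product_space I -> \bar R) :
  gaussian_law s mu -> measurable_fun setT f -> (forall x, 0 <= f x)%E ->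
  (\int[mu]_x f x =
   \int[mu]_x \int[normal_prob 0 (s l)]_t f (replace l (x, t)))%E.
Proof.
move=> gmu mf f0.
have mr := measurable_replace l.
pose pm := (mu \x (normal_prob 0 (s l)))%E.
have muE B : measurable B -> mu B = pushforward pm (replace l) B.
  apply: product_law_unique => A mA.
  rewrite gmu//= /pushforward.
  pose C i := if i == l then setT else A i.
  have mC i : measurable (C i) by rewrite /C; case: ifP.
  have -> : replace l @^-1` [set x | forall i, A i (x i)] =
      [set x | forall i, C i (x i)] `*` A l.
    apply/seteqP; rewrite /C; split => -[x t] /=; rewrite /replace.
      move=> h; split; last by have := h l; rewrite eqxx.
      by move=> i; have := h i; case: eqP.
    by move=> [h1 h2] i; have := h1 i; case: eqP => // ->.
  have H := product_measure1E mu (normal_prob 0 (s l)) (measurable_rectangle mC) (mA l).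
  apply: etrans (esym H); rewrite /= gmu//.
  rewrite (bigD1 l)//= [in RHS](bigD1 l)//= {1}/C eqxx probability_setT mul1e muleC.
  by congr (_ * _)%E; apply: eq_bigr => i /negbTE il; rewrite /C il.
rewrite (eq_measure_integral (pushforward pm (replace l))); last by move=> A mA _; exact: muE.
have := ge0_integral_pushforward mr pm measurableT mf.
rewrite preimage_setT => ->//.
rewrite /pm fubini_tonelli1//; first exact: measurableT_comp mf mr.
by move=> x; exact: f0.
Qed.

(** The density, with respect to the centered Gaussian law with deviations [s], of its translate by
    [a]. *)
Definition shift_weight I (s a : I -> R) (x : product_space I) : R :=
  expR (\sum_i (a i * x i - a i ^+ 2 / 2) / s i ^+ 2).

Definition add_vec I (a : I -> R) (x : product_space I) : product_space I :=
  fun i => x i + a i.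

Lemma measurable_add_vec I (a : I -> R) : measurable_fun setT (add_vec a).
Proof.
apply: measurable_to_product => i; apply: measurable_funD => //.
exact: measurable_coord.
Qed.

Lemma measurable_shift_weight I (s a : I -> R) :
  measurable_fun setT (shift_weight s a).
Proof.
apply: measurableT_comp => //; apply: measurable_sum => i.
apply: measurable_funM => //; apply: measurable_funB => //.
by apply: measurable_funM => //; exact: measurable_coord.
Qed.

Definition cameron_martin I (s : I -> R)
    (mu : {measure set (product_space I) -> \bar R}) (a : I -> R) :=
  forall f : product_space I -> \bar R,
    measurable_fun setT f -> (forall x, 0 <= f x)%E ->
  (\int[mu]_x f (add_vec a x) = \int[mu]_x (f x * (shift_weight s a x)%:E))%E.

Lemma cameron_martinD I (s a b : I -> R)
    (mu : {measure set (product_space I) -> \bar R}) :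
  cameron_martin s mu a -> cameron_martin s mu b ->
  cameron_martin s mu (fun i => a i + b i).
Proof.
move=> cma cmb f mf f0.
transitivity (\int[mu]_x f (add_vec b (add_vec a x)))%E.
  by apply: eq_integral => x _; congr f; apply/funext => i; rewrite /add_vec addrA.
rewrite (cma (f \o add_vec b)); last 2 first.
- exact: measurableT_comp mf (measurable_add_vec b).
- by move=> x; exact: f0.
(* The first weight is moved back by [b] so that the formula for [b] can absorb it; the resulting
   cross term [- a b] completes the square of [a + b]. *)
pose g x := (f x * (shift_weight s a (add_vec (fun i => - b i) x))%:E)%E.
transitivity (\int[mu]_x g (add_vec b x))%E.
  apply: eq_integral => x _; congr (f _ * (shift_weight s a _)%:E)%E.
  by apply/funext => i; rewrite /add_vec addrK.
rewrite cmb; last 2 first.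
- apply: emeasurable_funM => //; apply/measurable_EFinP.
  exact: measurableT_comp (measurable_shift_weight s a) (measurable_add_vec _).
- by move=> x; rewrite mule_ge0// lee_fin expR_ge0.
apply: eq_integral => x _; rewrite /g /shift_weight -muleA -EFinM -expRD -big_split.
congr (_ * (expR _)%:E)%E; apply: eq_bigr => i _ /=.
by rewrite /add_vec -mulrDl; congr (_ / _); lra.
Qed.

Lemma cameron_martin0 I (s : I -> R)
    (mu : {measure set (product_space I) -> \bar R}) :
  cameron_martin s mu (fun=> 0).
Proof.
move=> f mf f0; apply: eq_integral => x _.
have -> : add_vec (fun=> 0) x = x by apply/funext => i; exact: addr0.
rewrite /shift_weight big1 ?expR0 ?mule1// => i _.
by rewrite expr0n/= !mul0r subrr mul0r.
Qed.

(** Resampling the coordinate [l] isolates it and leaves the one-dimensional translation formula, as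
    the weight depends on [x l] alone. *)
Lemma cameron_martin_coord I (s : I -> R)
    (mu : probability (product_space I) R) (l : I) (c : R) :
  (s l != 0) -> gaussian_law s mu ->
  cameron_martin s mu (fun i => if i == l then c else 0).
Proof.
move=> sl0 gmu f mf f0.
have swE x : shift_weight s (fun i => if i == l then c else 0) x =
    expR ((c * x l - c ^+ 2 / 2) / s l ^+ 2).
  rewrite /shift_weight (bigD1 l)//= eqxx big1 ?addr0// => i /negbTE ->.
  by rewrite expr0n/= !mul0r subrr mul0r.
have ma := measurable_add_vec (fun i => if i == l then c else 0).
rewrite (gaussian_resample l gmu (measurableT_comp mf ma)); last by move=> x; exact: f0.
set v := fun i => if i == l then c else 0.
have mfw : measurable_fun setT (fun x => f x * (shift_weight s v x)%:E)%E.
  apply: emeasurable_funM => //; apply/measurable_EFinP.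
  exact: measurable_shift_weight.
rewrite (gaussian_resample l gmu mfw); last first.
  by move=> x; rewrite mule_ge0// lee_fin expR_ge0.
apply: eq_integral => x _.
have mrx : measurable_fun setT (fun t : R => f (replace l (x, t))).
  apply: measurableT_comp mf _.
  exact: (measurableT_comp (measurable_replace l) (pair1_measurable x)).
transitivity (\int[normal_prob 0 (s l)]_t f (replace l (x, (t : R) + c)%R))%E.
  apply: eq_integral => t _; congr f; apply/funext => i.
  by rewrite /add_vec /replace /v/=; case: eqP => // _; rewrite addr0.
rewrite (normal_prob_shift _ sl0 mrx)//; apply: eq_integral => t _.
by rewrite /v swE /replace /= eqxx.
Qed.

Lemma gaussian_cameron_martin I (s a : I -> R)
    (mu : probability (product_space I) R) :
  (forall i, s i != 0) -> gaussian_law s mu -> cameron_martin s mu a.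
Proof.
move=> s0 gmu.
have -> : a = fun i => \sum_(l <- enum I) (if i == l then a l else 0).
  apply/funext => i; rewrite big_enum (bigD1 i)//= eqxx big1 ?addr0// => l.
  by rewrite eq_sym => /negbTE ->.
elim: (enum I) => [|l r IH].
  have -> : (fun i : I => \sum_(l <- [::]) (if i == l then a l else 0)) = fun=> 0.
    by apply/funext => i; rewrite big_nil.
  exact: cameron_martin0.
have -> : (fun i : I => \sum_(j <- l :: r) (if i == j then a j else 0)) =
    fun i => (if i == l then a l else 0) +
             \sum_(j <- r) (if i == j then a j else 0).
  by apply/funext => i; rewrite big_cons.
by apply: cameron_martinD => //; exact: cameron_martin_coord.
Qed.

End finite_product_space.
Arguments product_space R I : clear implicits.
Arguments rectangles R I : clear implicits.

(** * Linear images, mixtures and null sets of Gaussian laws *)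

Section gaussian_vectors.
Context {R : realType}.
Implicit Types I J : finType.

Lemma shift_weight1 I (a : I -> R) (x : product_space R I) :
  shift_weight (fun=> 1) a x = expR (\sum_i (a i * x i - a i ^+ 2 / 2)).
Proof. by congr expR; apply: eq_bigr => i _; rewrite expr1n divr1. Qed.

(* Expanding [nu B] with the shift formula of [nu] at [x], averaging over
   [x] under [mu] and using the shift formula of [mu] at [y] trades [nu B] for
   [mu B]. *)
Lemma cameron_martin_unique J (mu nu : probability (product_space R J) R) :
  (forall a, cameron_martin (fun=> 1) mu a) ->
  (forall a, cameron_martin (fun=> 1) nu a) ->
  forall B, measurable B -> mu B = nu B.
Proof.
move=> cmmu cmnu B mB; apply/esym.
(* [E1] is minus the exponent of the weight for the shift [x] read at [x + y], and [E2] is that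
   exponent read at [y]. *)
pose E1 (p : product_space R J * product_space R J) : R :=
  \sum_i - (p.1 i * p.2 i + p.1 i ^+ 2 / 2).
pose E2 (p : product_space R J * product_space R J) : R :=
  \sum_i (p.1 i * p.2 i - p.1 i ^+ 2 / 2).
have mp1 i : measurable_fun setT
    (fun p : product_space R J * product_space R J => p.1 i : R).
  exact: (measurableT_comp (measurable_coord i) measurable_fst).
have mp2 i : measurable_fun setT
    (fun p : product_space R J * product_space R J => p.2 i : R).
  exact: (measurableT_comp (measurable_coord i) measurable_snd).
have mE1 : measurable_fun setT E1.
  apply: measurable_sum => i; apply: measurableT_comp => //.
  apply: measurable_funD; first exact: measurable_funM.
  by apply: measurable_funM => //; exact: measurable_funX.
have mE2 : measurable_fun setT E2.
  apply: measurable_sum => i; apply: measurable_funB; first exact: measurable_funM.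
  by apply: measurable_funM => //; exact: measurable_funX.
have mB1 : measurable_fun setT (\1_B : product_space R J -> R) by exact: measurable_indic.
have mS : measurable_fun setT
    (fun p : product_space R J * product_space R J => add_vec (p.1 : J -> R) p.2).
  by apply: measurable_to_product => i; exact: measurable_funD.
pose F (p : product_space R J * product_space R J) : \bar R :=
  (\1_B (add_vec (p.1 : J -> R) p.2) * expR (E1 p))%:E.
have mF : measurable_fun setT F.
  apply/measurable_EFinP; apply: measurable_funM; first exact: measurableT_comp mB1 mS.
  exact: measurableT_comp.
have F0 p : (0 <= F p)%E by rewrite lee_fin mulr_ge0// ?expR_ge0.
pose G (p : product_space R J * product_space R J) : \bar R := (\1_B p.1 * expR (E2 p))%:E.
have mG : measurable_fun setT G.
  apply/measurable_EFinP; apply: measurable_funM.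
    exact: measurableT_comp mB1 measurable_fst.
  exact: measurableT_comp.
have G0 p : (0 <= G p)%E by rewrite lee_fin mulr_ge0// ?expR_ge0.
have shift_nu x : (\int[nu]_y (\1_B y)%:E = \int[nu]_y F (x, y))%E.
  pose h (y : product_space R J) := ((\1_B y)%:E *
    (expR (- \sum_i (x i * y i - x i ^+ 2 / 2)))%:E)%E.
  transitivity (\int[nu]_y h (add_vec x y))%E.
    rewrite cmnu; last 2 first.
    - apply: emeasurable_funM; first exact/measurable_EFinP.
      apply/measurable_EFinP/measurableT_comp => //; apply: measurableT_comp => //.
      apply: measurable_sum => i; apply: measurable_funB => //.
      by apply: measurable_funM => //; exact: measurable_coord.
    - by move=> y; rewrite mule_ge0// lee_fin ?expR_ge0.
    apply: eq_integral => y _; rewrite /h shift_weight1 -muleA -EFinM -expRD.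
    by rewrite addNr expR0 mulr1.
  apply: eq_integral => y _; rewrite /h /F /E1 -EFinM /= -sumrN.
  congr (_ * expR _)%:E; apply: eq_bigr => i _; rewrite /add_vec; lra.
have shift_mu y : (\int[mu]_x F (x, y) = \int[mu]_x G (x, y))%E.
  pose k (z : product_space R J) := ((\1_B z)%:E *
    (expR (\sum_i (y i ^+ 2 / 2 - z i ^+ 2 / 2)))%:E)%E.
  transitivity (\int[mu]_x k (add_vec y x))%E.
    apply: eq_integral => x _; rewrite /k /F /E1 -EFinM /=.
    have -> : add_vec y x = add_vec (x : J -> R) y.
      by apply/funext => i; rewrite /add_vec addrC.
    congr (_ * expR _)%:E; apply: eq_bigr => i _; rewrite /add_vec; lra.
  rewrite cmmu; last 2 first.
  - apply: emeasurable_funM; first exact/measurable_EFinP.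
    apply/measurable_EFinP/measurableT_comp => //.
    apply: measurable_sum => i; apply: measurable_funB => //.
    by apply: measurable_funM => //; apply: measurable_funX; exact: measurable_coord.
  - by move=> z; rewrite mule_ge0// lee_fin ?expR_ge0.
  apply: eq_integral => x _; rewrite /k /G /E2 shift_weight1 -muleA -!EFinM -expRD.
  rewrite -big_split /=; congr (_ * expR _)%:E; apply: eq_bigr => i _ /=.
  lra.
transitivity (\int[mu]_x \int[nu]_y F (x, y))%E.
  rewrite (eq_integral (cst (nu B))); last first.
    by move=> x _; rewrite /= -shift_nu integral_indic// setIT.
  by rewrite integral_cst// [X in (_ * X)%E](probability_setT mu) mule1.
rewrite fubini_tonelli//.
under eq_integral do rewrite shift_mu.
rewrite -(fubini_tonelli G)//.
transitivity (\int[mu]_x (\1_B x)%:E)%E; last by rewrite integral_indic// setIT.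
apply: eq_integral => x _.
rewrite /G; under eq_integral do rewrite /= EFinM.
rewrite ge0_integralZl//; last first.
  apply/measurable_EFinP/measurableT_comp => //.
  exact: (measurableT_comp mE2 (pair1_measurable x)).
rewrite [X in (_ * X)%E](_ : _ = 1%E) ?mule1//.
(* What is left is the weight for the shift [x]; its mean under [nu] is one by the shift formula for
   the constant function. *)
transitivity (\int[nu]_y cst 1%E (add_vec x y))%E; last first.
  by rewrite /= integral_cst// [X in (_ * X)%E](probability_setT nu) mule1.
rewrite cmnu//; apply: eq_integral => y _; by rewrite mul1e shift_weight1.
Qed.

Definition linear_map I J (L : J -> I -> R) (x : product_space R I) :
  product_space R J := fun j => \sum_i L j i * x i.

Lemma measurable_linear_map I J (L : J -> I -> R) :
  measurable_fun setT (linear_map L).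
Proof.
apply: measurable_to_product => j; apply: measurable_sum => i.
by apply: measurable_funM => //; exact: measurable_coord.
Qed.

HB.instance Definition _ I J (L : J -> I -> R) :=
  isMeasurableFun.Build _ _ _ _ (linear_map L) (measurable_linear_map L).

(** With [D] the diagonal of the [s i ^+ 2], a shift [a] of the image lifts to the shift
    [v = D L^T a]: the hypothesis gives [L v = a], and the weight of [v] at [x] equals the standard
    weight of [a] at [L x]. The image thus satisfies the standard shift formula, which identifies
    it. *)
Lemma gaussian_linear_map I J (s : I -> R) (L : J -> I -> R)
    (mu : probability (product_space R I) R)
    (gam : probability (product_space R J) R) :
  (forall i, s i != 0) -> gaussian_law s mu -> gaussian_law (fun=> 1) gam ->
  (forall j j', \sum_i L j i * L j' i * s i ^+ 2 = (j == j')%:R) ->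
  forall B, measurable B -> mu (linear_map L @^-1` B) = gam B.
Proof.
move=> s0 gmu ggam LL B mB.
apply: (cameron_martin_unique (mu := distribution mu (linear_map L)) _ _ mB); last first.
  by move=> a; apply: gaussian_cameron_martin => // i; exact: oner_neq0.
move=> a f mf f0.
have fa0 y : (0 <= (f \o add_vec a) y)%E by exact: f0.
pose v i := s i ^+ 2 * \sum_j L j i * a j.
have Lv j : \sum_i L j i * v i = a j.
  under eq_bigr do rewrite /v mulrA mulr_sumr.
  rewrite exchange_big /= (bigD1 j)//= [X in _ + X]big1 ?addr0.
    under eq_bigr do rewrite mulrA [_ * _ * L j _]mulrAC.
    by rewrite -mulr_suml LL eqxx mul1r.
  move=> j' jj'; under eq_bigr do rewrite mulrA [_ * _ * L j' _]mulrAC.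
  by rewrite -mulr_suml LL eq_sym (negbTE jj') mul0r.
rewrite (ge0_integral_distribution _ (measurableT_comp mf (measurable_add_vec a)))//.
rewrite ge0_integral_distribution; last 2 first.
- apply: emeasurable_funM => //; apply/measurable_EFinP.
  exact: measurable_shift_weight.
- by move=> y; rewrite mule_ge0// lee_fin expR_ge0.
transitivity (\int[mu]_x (f \o linear_map L) (add_vec v x))%E.
  apply: eq_integral => x _; congr f; apply/funext => j.
  rewrite /add_vec /linear_map -Lv -big_split/=; apply: eq_bigr => i _.
  by rewrite mulrDr.
rewrite (gaussian_cameron_martin _ s0 gmu); last 2 first.
- exact: measurableT_comp mf (measurable_linear_map L).
- by move=> x; exact: f0.
apply: eq_integral => x _; congr (_ * (expR _)%:E)%E.
have vs i : v i / s i ^+ 2 = \sum_j L j i * a j.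
  by rewrite /v mulrAC mulfV ?mul1r// expf_neq0.
transitivity (\sum_i (v i / s i ^+ 2) * (x i - v i / 2)).
  by apply: eq_bigr => i _; field.
under eq_bigr do rewrite vs mulr_suml.
rewrite exchange_big/=; apply: eq_bigr => j _.
transitivity (a j * (\sum_i L j i * x i) - a j / 2 * \sum_i L j i * v i).
  by rewrite !mulr_sumr -sumrB; apply: eq_bigr => i _; field.
by rewrite Lv expr1n divr1 /linear_map; field.
Qed.

(** The translated law has density [shift_weight] with respect to [mu], hence is dominated by it. *)
Lemma gaussian_shift_null I (s a : I -> R)
    (mu : probability (product_space R I) R) B :
  (forall i, s i != 0) -> gaussian_law s mu -> measurable B -> mu B = 0%E ->
  mu (add_vec a @^-1` B) = 0%E.
Proof.
move=> s0 gmu mB muB0.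
have mB1 : measurable_fun setT (\1_B : product_space R I -> R) by exact: measurable_indic.
have maB : measurable (add_vec a @^-1` B).
  by rewrite -[X in measurable X]setTI; exact: measurable_add_vec.
transitivity (\int[mu]_x (EFin \o \1_B) (add_vec a x))%E.
  by rewrite -[in LHS](setIT (add_vec a @^-1` B)) -integral_indic.
rewrite (gaussian_cameron_martin _ s0 gmu (f := EFin \o \1_B)); last 2 first.
- exact/measurable_EFinP.
- by move=> x; rewrite lee_fin.
transitivity (\int[mu]_(x in B) (shift_weight s a x)%:E)%E.
  rewrite [RHS]integral_mkcond; apply: eq_integral => x _.
  by rewrite patchE /= indicE; case: ifP => _; rewrite ?mul1e ?mul0e.
apply: null_set_integral => //; apply/measurable_EFinP/measurable_funTS.
exact: measurable_shift_weight.
Qed.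

Definition mix J (c d : R) (p : (product_space R J * product_space R J)%type) :
  product_space R J := fun j => c * p.1 j + d * p.2 j.

Lemma measurable_mix J c d : measurable_fun setT (@mix J c d).
Proof.
apply: measurable_to_product => i; apply: measurable_funD.
  apply: measurable_funM => //.
  exact: (measurableT_comp (measurable_coord i) measurable_fst).
apply: measurable_funM => //.
exact: (measurableT_comp (measurable_coord i) measurable_snd).
Qed.

HB.instance Definition _ J c d :=
  isMeasurableFun.Build _ _ _ _ (@mix J c d) (measurable_mix c d).

(** Rotation invariance: a shift [a] of the mixture comes from the shifts [c a] and [d a] of the two
    independent components, and [c^2 + d^2 = 1] makes both the shifts and the exponents of the
    weights add up to those of [a]. *)
Lemma gaussian_mix J (c d : R) (gam : probability (product_space R J) R) :
  c ^+ 2 + d ^+ 2 = 1 -> gaussian_law (fun=> 1) gam ->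
  forall B, measurable B -> (gam \x gam)%E (@mix J c d @^-1` B) = gam B.
Proof.
move=> cd1 ggam.
have n1 (i : J) : (1 : R) != 0 by exact: oner_neq0.
apply: (cameron_martin_unique (mu := distribution (gam \x gam)%E (@mix J c d))); last first.
  by move=> a; exact: gaussian_cameron_martin.
move=> a f mf f0.
have mfa := measurableT_comp mf (measurable_add_vec a).
rewrite (ge0_integral_distribution _ mfa); last by move=> x; exact: f0.
have mfw : measurable_fun setT (fun x => f x * (shift_weight (fun=> 1) a x)%:E)%E.
  apply: emeasurable_funM => //; apply/measurable_EFinP.
  exact: measurable_shift_weight.
have fw0 x : (0 <= f x * (shift_weight (fun=> 1) a x)%:E)%E.
  by rewrite mule_ge0// lee_fin expR_ge0.
rewrite (ge0_integral_distribution _ mfw)//.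
pose g p := f (mix c d p).
have mg : measurable_fun setT g := measurableT_comp mf (measurable_mix c d).
have g0 p : (0 <= g p)%E by exact: f0.
pose w b (x : product_space R J) := (shift_weight (fun=> 1) (fun i => b * a i) x)%:E.
have mw b : measurable_fun setT (w b) 
  by apply/measurable_EFinP; exact: measurable_shift_weight.
have w0 b x : (0 <= w b x)%E by rewrite lee_fin expR_ge0.
pose h1 (p : product_space R J * product_space R J) :=
  (g (add_vec (fun i => (c * a i)%R) p.1, p.2) * w d p.2)%E.
pose h2 (p : product_space R J * product_space R J) :=
  (g p * w c p.1 * w d p.2)%E.
have mh1 : measurable_fun setT h1.
  apply: emeasurable_funM; last exact: (measurableT_comp (mw d) measurable_snd).
  apply: (measurableT_comp mg); apply: measurable_fun_pair => //.
  exact: (measurableT_comp (measurable_add_vec _) measurable_fst).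
have mh2 : measurable_fun setT h2.
  apply: emeasurable_funM; last exact: (measurableT_comp (mw d) measurable_snd).
  apply: emeasurable_funM; first exact: mg.
  exact: (measurableT_comp (mw c) measurable_fst).
transitivity (\int[gam]_x \int[gam]_y h1 (x, y))%E.
  rewrite fubini_tonelli1; last 2 first.
  - exact: measurableT_comp mfa (measurable_mix c d).
  - by move=> x; exact: f0.
  apply: eq_integral => x _; rewrite /fubini_F.
  rewrite -(gaussian_cameron_martin _ n1 ggam (f := fun y => g (_, y))); last 2 first.
  - exact: (measurableT_comp mg (pair1_measurable (add_vec (fun i => c * a i) x))).
  - by move=> y; exact: g0.
  apply: eq_integral => y _; congr f; apply/funext => i.
  transitivity (c * x i + d * y i + (c ^+ 2 + d ^+ 2) * a i).
    by rewrite cd1 mul1r.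
  by rewrite /mix /add_vec /=; ring.
rewrite (fubini_tonelli h1)//; last by move=> p; rewrite mule_ge0.
transitivity (\int[gam]_y \int[gam]_x h2 (x, y))%E.
  apply: eq_integral => y _.
  have mgy : measurable_fun setT (fun x => g (x, y)).
    exact: (measurableT_comp mg (pair2_measurable y)).
  have mgay : measurable_fun setT (fun x => g (add_vec (fun i => c * a i) x, y)).
    exact: (measurableT_comp mgy (measurable_add_vec _)).
  rewrite /h1 /h2 /= (ge0_integralZr gam measurableT mgay)//.
  have mgw : measurable_fun setT (fun x => g (x, y) * w c x)%E.
    exact: emeasurable_funM.
  rewrite (ge0_integralZr gam measurableT mgw)//; last by move=> x _; rewrite mule_ge0.
  congr (_ * _)%E.
  by rewrite (gaussian_cameron_martin _ n1 ggam (f := fun x => g (x, y))).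
rewrite -(fubini_tonelli h2)//; last by move=> p; rewrite !mule_ge0.
rewrite -fubini_tonelli1//; last by move=> p; rewrite !mule_ge0.
apply: eq_integral => -[x y] _; rewrite /h2 /g /w -muleA -EFinM; congr (_ * _%:E)%E.
rewrite !shift_weight1 -expRD -big_split/=; congr expR; apply: eq_bigr => i _.
transitivity (a i * mix c d (x, y) i - (c ^+ 2 + d ^+ 2) * a i ^+ 2 / 2).
  by rewrite /mix /=; ring.
by rewrite cd1 mul1r.
Qed.

Lemma integral_eq0_exists d (T : measurableType d) (P : probability T R)
    (f : T -> \bar R) :
  measurable_fun setT f -> (forall x, 0 <= f x)%E -> (\int[P]_x f x = 0)%E ->
  exists x, f x = 0%E.
Proof.
move=> mf f0 if0.
have : ae_eq P setT f (cst 0%E).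
  apply/ae_eq_integral_abs => //; rewrite -[RHS]if0.
  by apply: eq_integral => x _; rewrite gee0_abs.
move=> [N [mN N0 fN]]; apply: contrapT => nf.
have NT : N = setT.
  apply/seteqP; split => // x _; apply: fN => /= /(_ Logic.I) fx.
  by apply: nf; exists x.
by have := probability_setT P; rewrite -[setT]NT N0 => /esym/eqP; rewrite onee_eq0.
Qed.

(* For independent [x], [y] of law [gam] and [d^2 + c^2 = 1], [d x + c y] has law
   [gam]; so for some [x] the shift of [c y] by [d x] almost surely avoids [B],
   and shifts preserve null sets. *)
Lemma gaussian_contract_null J (c : R) (gam : probability (product_space R J) R) B :
  gaussian_law (fun=> 1) gam -> 0 < c <= 1 -> measurable B -> gam B = 0%E ->
  gam ((fun x j => c * x j) @^-1` B) = 0%E.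
Proof.
move=> ggam /andP[c0 c1] mB gB0.
pose d := Num.sqrt (1 - c ^+ 2).
have dc1 : d ^+ 2 + c ^+ 2 = 1.
  by rewrite sqr_sqrtr ?subrK// subr_ge0 expr_le1// ltW.
have mmB : measurable (@mix J d c @^-1` B).
  by rewrite -[X in measurable X]setTI; exact: measurable_mix.
have [x gx0] : exists x, (gam \o xsection (@mix J d c @^-1` B)) x = 0%E.
  apply: (integral_eq0_exists (P := gam)).
  - exact: measurable_fun_xsection.
  - by move=> x; exact: measure_ge0.
  - by rewrite -[RHS]gB0 -(gaussian_mix dc1 ggam mB).
have mxB : measurable (xsection (@mix J d c @^-1` B) x) by exact: measurable_xsection.
have n1 (i : J) : (1 : R) != 0 by exact: oner_neq0.
(* [d x + c y] is [c] times [y + (d / c) x], so undoing a translation by [(d / c) x] leaves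
   [c y]. *)
rewrite -[RHS](gaussian_shift_null (fun i => - (d / c * x i)) n1 ggam mxB gx0).
congr (gam _); apply/seteqP; rewrite /xsection; split => y /=.
  rewrite inE /= /mix/= /add_vec => By.
  suff -> : (fun j => d * x j + c * (y j - d / c * x j)) = (fun j => c * y j) by [].
  by apply/funext => j; field; rewrite gt_eqF.
rewrite inE /= /mix/= /add_vec.
suff -> : (fun j => d * x j + c * (y j - d / c * x j)) = (fun j => c * y j) by [].
by apply/funext => j; field; rewrite gt_eqF.
Qed.

End gaussian_vectors.

(** * Seminorms of Gaussian vectors *)

Section seminorm_law.
Context {R : realType} {J : finType}.

Definition seminorm (N : (J -> R) -> R) :=
  (forall x y, N (fun j => x j + y j) <= N x + N y) /\
  (forall c x, N (fun j => c * x j) = `|c| * N x).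

Variable N : (J -> R) -> R.
Hypothesis semiN : seminorm N.

Let N_sub x y : N (fun j => x j + y j) <= N x + N y. Proof. exact: semiN.1. Qed.
Let N_hom c x : N (fun j => c * x j) = `|c| * N x. Proof. exact: semiN.2. Qed.

Lemma seminorm0 : N (fun=> 0) = 0.
Proof.
have -> : (fun=> 0) = (fun j : J => 0 * (0 : R)) by apply/funext => j; rewrite mul0r.
by rewrite (N_hom 0 (fun=> 0)) normr0 mul0r.
Qed.

Lemma seminorm_ge0 x : 0 <= N x.
Proof.
have := N_sub x (fun j => -1 * x j); rewrite N_hom normrN1 mul1r.
have -> : (fun j => x j + -1 * x j) = fun=> 0.
  by apply/funext => j; rewrite mulN1r subrr.
by rewrite seminorm0 -mulr2n pmulrn_lge0.
Qed.

Let unit_vec (l j : J) : R := (j == l)%:R.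
Let gap (x z : J -> R) := \sum_l `|x l - z l| * N (unit_vec l).

Let N_gap x z : N x <= N z + gap x z.
Proof.
have sumN (s : seq J) (y : J -> R) :
    N (fun j => \sum_(l <- s) y l * unit_vec l j) <=
    \sum_(l <- s) `|y l| * N (unit_vec l).
  elim: s => [|l s IH].
    rewrite big_nil; under eq_fun do rewrite big_nil.
    by rewrite seminorm0.
  rewrite big_cons; under eq_fun do rewrite big_cons.
  apply: le_trans (N_sub (fun j => y l * unit_vec l j) _) _.
  by rewrite lerD// (N_hom (y l) (unit_vec l)).
have -> : x = fun j => z j + \sum_(l <- enum J) (x l - z l) * unit_vec l j.
  apply/funext => j; rewrite big_enum (bigD1 j)//= big1 ?addr0.
    by rewrite /unit_vec eqxx mulr1 subrKC.
  by move=> l lj; rewrite /unit_vec eq_sym (negbTE lj) mulr0.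
apply: le_trans (N_sub _ _) _; rewrite lerD2l.
apply: le_trans (sumN _ _) _.
rewrite big_enum /gap/= le_eqVlt; apply/orP; left; apply/eqP.
apply: eq_bigr => l _; congr (`|_| * _).
rewrite big_enum (bigD1 l)//= big1 ?addr0 /unit_vec ?eqxx ?mulr1 ?subrKC//.
by move=> i il; rewrite eq_sym (negbTE il) mulr0.
Qed.

Let gap_rat (x : J -> R) (e : R) : 0 < e ->
  exists z : {ffun J -> rat}, gap x (fun j => ratr (z j)) < e.
Proof.
(* Adding 1 keeps [K] positive and makes the final bound strict. *)
move=> e0; pose K := 1 + \sum_l N (unit_vec l).
have K0 : 0 < K by rewrite ltr_pwDl// sumr_ge0// => l _; exact: seminorm_ge0.
have eK : 0 < e / K by rewrite divr_gt0.
have /(_ _)/cid-/all_sig[q qP] j : exists q : rat, `|x j - ratr q| < e / K.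
  have /rat_in_itvoo[q] : x j - e / K < x j + e / K by lra.
  rewrite in_itv/= => /andP[q1 q2]; exists q; rewrite ltr_norml; apply/andP; split; lra.
exists [ffun j => q j].
apply: (@le_lt_trans _ _ (\sum_l e / K * N (unit_vec l))).
  apply: ler_sum => l _; rewrite ler_wpM2r ?seminorm_ge0//.
  by rewrite ffunE ltW.
rewrite -mulr_sumr mulrAC ltr_pdivrMr// ltr_pM2l// /K; lra.
Qed.

(* A seminorm [N] is Lipschitz, so [N x < c] holds if and only if
   [N z + gap x z < c] for some rational vector [z]. *)
Lemma measurable_seminorm :
  measurable_fun setT (N : product_space R J -> R).
Proof.
apply: (measurability (@RGenInftyO.G R) (RGenInftyO.measurableE R)).
move=> _ [_ [c ->] <-]; rewrite setTI.
have -> : (N : product_space R J -> R) @^-1` `]-oo, c[ =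
    \bigcup_(z : {ffun J -> rat})
      [set x | N (fun j => ratr (z j)) + gap x (fun j => ratr (z j)) < c].
  apply/seteqP; split => x /=; rewrite in_itv/=.
    (* Half of the margin is allotted because two gaps are spent: one to pass from [N z] to [N x],
       one in the defining condition. *)
    move=> Nxc; have [z zP] := @gap_rat x ((c - N x) / 2) ltac:(lra).
    exists z => //=.
    have := N_gap (fun j => ratr (z j)) x.
    have -> : gap (fun j => ratr (z j)) x = gap x (fun j => ratr (z j)).
      by apply: eq_bigr => l _; rewrite distrC.
    lra.
  by move=> [z _ /=]; apply: le_lt_trans; exact: N_gap.
apply: countable_bigcupT_measurable => [|z]; first exact: countableP.
pose h (x : product_space R J) := N (fun j => ratr (z j)) + gap x (fun j => ratr (z j)).
have mh : measurable_fun setT h.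
  apply: measurable_funD => //; apply: measurable_sum => l.
  apply: measurable_funM => //; apply: measurableT_comp => //.
  by apply: measurable_funB => //; exact: measurable_coord.
have -> : [set x | h x < c] = setT `&` h @^-1` `]-oo, c[.
  by rewrite setTI; apply/seteqP; split => x /=; rewrite in_itv.
exact: mh.
Qed.

Variable gam : probability (product_space R J) R.
Hypothesis ggam : gaussian_law (fun=> 1) gam.
Hypothesis N_neq0 : exists v, N v != 0.

Let one_neq0 (i : J) : (1 : R) != 0. Proof. exact: oner_neq0. Qed.

Lemma measurable_seminorm_preimage (B : set R) : measurable B ->
  measurable ((N : product_space R J -> R) @^-1` B).
Proof. by move=> mB; rewrite -[X in measurable X]setTI; exact: measurable_seminorm. Qed.

(** A law has countably many atoms, and a countable set cannot contain an interval of positive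
    Lebesgue measure. *)
Let exists_nonatom (a b : R) : a < b ->
  exists2 r, a < r < b & gam (N @^-1` [set r]) = 0%E.
Proof.
move=> ab; apply: contrapT => no.
pose X : {RV gam >-> R} := HB.pack (N : product_space R J -> R)
  (isMeasurableFun.Build _ _ _ _ _ measurable_seminorm).
have sub : `]a, b[ `<=` [set r | 0 < pmf X r].
  move=> r /=; rewrite in_itv/= => rab; rewrite lt_neqAle pmf_ge0 andbT.
  apply/negP => /eqP pmf0; apply: no; exists r => //.
  by rewrite -[LHS]fineK ?fin_num_measure//= -/(pmf X r) -?pmf0//; exact: measurable_seminorm_preimage.
have /countable_lebesgue_measure0 := sub_countable (subset_card_le sub) (pmf_gt0_countable (P := gam) X).
rewrite lebesgue_measure_itv/= lte_fin ab -EFinB => -[]; lra.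
Qed.

(* If [0] were an atom, shifting by a vector [w] with [N w = r] would make every
   [r > 0] an atom, as [N (x + w) = 0] forces [N x = N w]. *)
Lemma seminorm_atomless b : gam (N @^-1` [set b]) = 0%E.
Proof.
have mN r : measurable (N @^-1` [set r] : set (product_space R J)).
  exact: measurable_seminorm_preimage.
have [b0|b0|<-] := ltgtP 0 b.
(* By homogeneity, [N = b] is the preimage of [N = r] under contraction by [r / b]; the bound
   [b / 2] keeps [r] positive. *)
- have [r /andP[r1 r2] r0] : exists2 r, b / 2 < r < b & gam (N @^-1` [set r]) = 0%E.
    by apply: exists_nonatom; lra.
  have c01 : 0 < r / b <= 1 by rewrite divr_gt0 ?ler_pdivrMr ?mul1r//; lra.
  have rb0 : 0 <= r / b by case/andP: c01 => /ltW.
  rewrite -[RHS](gaussian_contract_null ggam c01 (mN r) r0); congr (gam _).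
  apply/seteqP; split => x /=; rewrite (N_hom (r / b)) (ger0_norm rb0).
    by move=> ->; rewrite divfK// gt_eqF.
  have rn0 : r / b != 0 by rewrite gt_eqF//; case/andP: c01.
  move=> h; apply: (mulfI rn0); rewrite h divfK// gt_eqF//.
- rewrite (_ : N @^-1` _ = set0) ?measure0//; apply/seteqP; split => // x /= Nb.
  by have := seminorm_ge0 x; rewrite Nb leNgt b0.
- have [v v0] := N_neq0.
  have Nv : 0 < N v by rewrite lt_neqAle eq_sym v0 seminorm_ge0.
  have [r /andP[r1 _] r0] : exists2 r, 0 < r < 1 & gam (N @^-1` [set r]) = 0%E.
    by apply: exists_nonatom; lra.
  pose w j := r / N v * v j.
  have Nw : N w = r by rewrite N_hom ger0_norm ?divfK// divr_ge0// ltW.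
  have mA : measurable (add_vec w @^-1` (N @^-1` [set 0])).
    by rewrite -[X in measurable X]setTI; exact: measurable_add_vec.
  have A0 : gam (add_vec w @^-1` (N @^-1` [set 0])) = 0%E.
    apply/eqP; rewrite -measure_le0 -r0 le_measure ?inE// => x /=.
    rewrite /add_vec => Nxw; apply/eqP; rewrite eq_le; apply/andP; split.
      have := N_sub (fun j => x j + w j) (fun j => -1 * w j).
      rewrite N_hom Nxw Nw normrN1 mul1r add0r.
      by under eq_fun do rewrite mulN1r addrK.
    have := N_sub (fun j => x j + w j) (fun j => -1 * x j).
    rewrite N_hom Nxw normrN1 mul1r add0r.
    by under eq_fun do rewrite mulN1r [x _ + _]addrC addrK; rewrite Nw.
  rewrite -[RHS](gaussian_shift_null (fun j => - w j) one_neq0 ggam mA A0).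
  congr (gam _); apply/seteqP; split => x /=; rewrite /add_vec.
    by under [in X in _ -> X]eq_fun do rewrite subrK.
  by under eq_fun do rewrite subrK.
Qed.

(** If the interval were null, so would be its preimages under all contractions, and the countably
    many rational ones cover a whole tail of [N]. A shift of large norm moves the complement of that
    tail into the tail, so the whole space would be null. *)
Lemma seminorm_itv_gt0 a b : 0 <= a < b -> (0 < gam (N @^-1` `]a, b[))%E.
Proof.
move=> /andP[a0 ab]; rewrite lt0e measure_ge0 andbT; apply/negP => /eqP ab0.
pose a' := (a + b) / 2.
have mN B : measurable B -> measurable (N @^-1` B : set (product_space R J)).
  exact: measurable_seminorm_preimage.
have a'b0 : gam (N @^-1` `]a', b[) = 0%E.
  apply/eqP; rewrite -measure_le0 -ab0 le_measure ?inE//; [exact: mN|exact: mN|].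
  by move=> x /=; rewrite !in_itv/= /a' => /andP[? ->]; rewrite andbT; lra.
have a'0 : 0 < a' by rewrite /a'; lra.
have tail0 : gam (N @^-1` `]a', +oo[) = 0%E.
  pose D (q : rat) : set (product_space R J) :=
    if 0 < (ratr q : R) <= 1 then
      (fun x j => ratr q * x j) @^-1` (N @^-1` `]a', b[) else set0.
  have nullD q : gam.-negligible (D q).
    rewrite /D; case: ifPn => [q01|_]; last exact: negligible_set0.
    apply/negligibleP.
      rewrite -[X in measurable X]setTI.
      have : measurable_fun setT
          (fun x : product_space R J => (fun j => ratr q * x j) : product_space R J).
        apply: measurable_to_product => j; apply: measurable_funM => //.
        exact: measurable_coord.
      by apply => //; exact: mN.
    exact: gaussian_contract_null ggam q01 (mN _ (measurable_itv _)) a'b0.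
  apply: measure_negligible; first exact: mN.
  pose F n := if unpickle n is Some q then D q else set0.
  apply: (@negligibleS _ _ _ gam (\bigcup_n F n)); last first.
    apply: negligible_bigcup => n; rewrite /F; case: unpickle => [q|].
      exact: nullD.
    exact: negligible_set0.
  move=> x /=; rewrite in_itv/= andbT => a'x.
  have x0 : 0 < N x by exact: lt_trans a'x.
  (* A rational factor [q <= 1] that brings [N x] into []a', b[]. *)
  have /rat_in_itvoo[q] : a' / N x < Num.min 1 (b / N x).
    by rewrite lt_min ltr_pdivrMr// mul1r a'x ltr_pM2r ?invr_gt0// /a'; lra.
  rewrite in_itv/= lt_min ltr_pdivrMr// ltr_pdivlMr// => /and3P[q1 q2 q3].
  have q0 : 0 < (ratr q : R) by rewrite -(pmulr_lgt0 _ x0); exact: lt_trans q1.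
  exists (pickle q); first exact: Logic.I.
  rewrite /F pickleK /D q0 (ltW q2)/=.
  by rewrite in_itv/= (N_hom (ratr q)) (ger0_norm (ltW q0)) q1 q3.
have [v v0] := N_neq0.
have Nv : 0 < N v by rewrite lt_neqAle eq_sym v0 seminorm_ge0.
(* Once [N w] exceeds [2 a'], the reverse triangle inequality turns [N x <= a'] into
   [N (x + w) > a']. *)
pose w j := (a' + a' + 1) / N v * v j.
have Nw : N w = a' + a' + 1.
  by rewrite N_hom ger0_norm ?divfK// divr_ge0// ltW//; lra.
have mtail := mN _ (measurable_itv `]a', +oo[).
have tailw := gaussian_shift_null w one_neq0 ggam mtail tail0.
have : gam setT = 0%E.
  apply: measure_negligible => //.
  apply: (@negligibleS _ _ _ gam
    (N @^-1` `]a', +oo[ `|` add_vec w @^-1` (N @^-1` `]a', +oo[))); last first.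
    apply: negligibleU; apply/negligibleP => //.
    by rewrite -[X in measurable X]setTI; exact: measurable_add_vec.
  move=> x _ /=; rewrite !in_itv/= !andbT /add_vec.
  have [//|Nx] := ltP a' (N x); first by left.
  right; have := N_sub (fun j => x j + w j) (fun j => -1 * x j).
  under eq_fun do rewrite mulN1r [x _ + _]addrC addrK.
  rewrite -[N [eta w]]/(N w) Nw N_hom normrN1 mul1r; lra.
by rewrite probability_setT => /eqP; rewrite onee_eq0.
Qed.

Lemma seminorm_le0_null : gam (N @^-1` `]-oo, 0]) = 0%E.
Proof.
rewrite -(seminorm_atomless 0); congr (gam _).
apply/seteqP; split => x /=; rewrite in_itv/=; last by move=> ->.
by move=> Nx; apply/eqP; rewrite eq_le Nx seminorm_ge0.
Qed.

End seminorm_law.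

(** * Quantiles *)

Section critical_value.
Context {R : realType}.

(** The clauses give, in turn, a continuous distribution function, its strict monotonicity on the
    nonnegative half-line, and the positivity of every quantile of positive level. *)
Definition continuous_positive_law (rho : probability R R) :=
  [/\ forall b, rho [set b] = 0%E,
      forall a b : R, 0 <= a < b -> (0 < rho `]a, b[%classic)%E &
      rho `]-oo, 0]%classic = 0%E].

Lemma measure_bigcup_le d (T : measurableType d) (mu : {measure set T -> \bar R})
    (F : (set T)^nat) (c : \bar R) :
  (forall n, measurable (F n)) -> nondecreasing_seq F ->
  (forall n, mu (F n) <= c)%E -> (mu (\bigcup_n F n) <= c)%E.
Proof.
move=> mF ndF Fc.
have cv := nondecreasing_cvg_mu (mu := mu) mF (bigcup_measurable (fun n _ => mF n)) ndF.
rewrite -(cvg_lim _ cv)//; apply: lime_le; first by apply/cvg_ex; eexists; exact: cv.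
exact: nearW.
Qed.

Lemma law_Nyo_le (rho : probability R R) (b : R) (c : \bar R) :
  (forall a : R, (a < b)%R -> rho `]-oo, a]%classic <= c)%E -> (rho `]-oo, b[%classic <= c)%E.
Proof.
move=> hc.
have -> : `]-oo, b[%classic = \bigcup_n `]-oo, b - n.+1%:R^-1]%classic.
  apply/seteqP; split => [y|y [n _]] /=; rewrite !in_itv/=.
    move=> /ltr_add_invr[n yn]; exists n => //=; rewrite in_itv/= lerBrDr; exact: ltW.
  by move=> /le_lt_trans; apply; rewrite ltrBlDr ltrDl.
apply: measure_bigcup_le => [n|m n mn|n]; first exact: measurable_itv.
  apply/subsetPset => y /=; rewrite !in_itv/= => /le_trans; apply.
  by rewrite lerD2l lerN2 lef_pV2 ?posrE// ler_nat.
by apply: hc; rewrite ltrBlDr ltrDl.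
Qed.

Lemma law_oy_le (rho : probability R R) (b : R) (c : \bar R) :
  (forall a : R, (b < a)%R -> rho `]a, +oo[%classic <= c)%E -> (rho `]b, +oo[%classic <= c)%E.
Proof.
move=> hc.
have -> : `]b, +oo[%classic = \bigcup_n `]b + n.+1%:R^-1, +oo[%classic.
  apply/seteqP; split => [y|y [n _]] /=; rewrite !in_itv/= !andbT.
    by move=> /ltr_add_invr[n yn]; exists n => //=; rewrite in_itv/= yn.
  by apply: lt_trans; rewrite ltrDl.
apply: measure_bigcup_le => [n|m n mn|n]; first exact: measurable_itv.
  apply/subsetPset => y /=; rewrite !in_itv/= !andbT; apply: le_lt_trans.
  by rewrite lerD2l lef_pV2 ?posrE// ler_nat.
by apply: hc; rewrite ltrDl.
Qed.

Section properties.
Variable rho : probability R R.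
Hypothesis rhoP : continuous_positive_law rho.

Lemma law_Nyc_split a b : a <= b ->
  rho `]-oo, b]%classic = (rho `]-oo, a]%classic + rho `]a, b]%classic)%E.
Proof.
move=> ab; rewrite -measureU//.
- congr (rho _); apply/seteqP; split => y /=; rewrite !in_itv/=.
    by move=> yb; have [|] := leP y a; [left|right].
  by case=> [/le_trans ya|/andP[]//]; exact: ya.
- apply/seteqP; split => // y /=; rewrite !in_itv/= => -[ya /andP[]].
  by rewrite ltNge ya.
Qed.

Lemma law_oy b : rho `]b, +oo[%classic = (1 - rho `]-oo, b]%classic)%E.
Proof. by rewrite -setCitvl probability_setC. Qed.

Lemma law_Nyo b : rho `]-oo, b[%classic = rho `]-oo, b]%classic.
Proof.
have [at0 _ _] := rhoP.
rewrite -(@setUitv1 _ _ -oo%O b true)// measureU//; last first.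
  by apply/seteqP; split => // y /=; rewrite in_itv/= => -[yb ye]; rewrite ye ltxx in yb.
by rewrite [X in (_ + X)%E](at0 b) adde0.
Qed.

Lemma law_cy b : rho `[b, +oo[%classic = (1 - rho `]-oo, b]%classic)%E.
Proof. by rewrite -law_Nyo -setCitvl probability_setC. Qed.

Lemma law_Nyc_fin b : rho `]-oo, b]%classic \is a fin_num.
Proof. exact: fin_num_measure. Qed.

Lemma law_Nyc_eq0 b : b <= 0 -> rho `]-oo, b]%classic = 0%E.
Proof.
have [_ _ r0] := rhoP; move=> b0; apply/eqP; rewrite -measure_le0 -r0 le_measure ?inE//.
by move=> y /=; rewrite !in_itv/= => /le_trans; exact.
Qed.

Lemma law_Nyc_lt a b : 0 <= a < b -> (rho `]-oo, a]%classic < rho `]-oo, b]%classic)%E.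
Proof.
have [_ pos _] := rhoP; move=> ab; have /andP[a0 /ltW ltab] := ab.
rewrite (law_Nyc_split ltab) -[ltLHS]adde0 lteD2lE ?law_Nyc_fin//.
apply: lt_le_trans (pos _ _ ab) _; rewrite le_measure ?inE//.
by move=> y /=; rewrite !in_itv/= => /andP[-> /ltW].
Qed.

Lemma law_Nyc_cvg1 (c : R) : c < 1 -> exists b, (c%:E < rho `]-oo, b]%classic)%E.
Proof.
move=> c1; apply: contrapT => no.
suff : (rho setT <= c%:E)%E by rewrite probability_setT lee_fin leNgt c1.
have -> : setT = \bigcup_n `]-oo, n%:R : R]%classic.
  apply/seteqP; split => // y _; exists (Num.truncn y).+1 => //=.
  by rewrite in_itv/= ltW// truncnS_gt.
apply: measure_bigcup_le => [n|m n mn|n]; first exact: measurable_itv.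
  by apply/subsetPset => y /=; rewrite !in_itv/= => /le_trans; apply; rewrite ler_nat.
by rewrite leNgt; apply/negP => h; apply: no; exists n%:R.
Qed.

(** The quantile is the supremum of the points where the distribution function is at most [c]. Its
    value there is at most [c] by left limits and the absence of an atom, and at least [c] by right
    limits, taken through upper tails. *)
Lemma quantile_exists (c : R) : 0 < c < 1 -> exists b, rho `]-oo, b]%classic = c%:E.
Proof.
move=> /andP[c0 c1].
pose S := [set b | (rho `]-oo, b]%classic <= c%:E)%E].
have S0 : S 0 by rewrite /S /= law_Nyc_eq0// lee_fin ltW.
have mono a b : a <= b -> (rho `]-oo, a]%classic <= rho `]-oo, b]%classic)%E.
  move=> ab; rewrite le_measure ?inE// => y /=.
  by rewrite !in_itv/= => /le_trans; exact.
have [u hu] := law_Nyc_cvg1 c1.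
have ubS : ubound S u.
  move=> b /= Sb; rewrite leNgt; apply/negP => /ltW /mono.
  by move=> /(lt_le_trans hu); rewrite ltNge Sb.
have supS : has_sup S by split; [exists 0|exists u].
exists (sup S); apply/eqP; rewrite eq_le; apply/andP; split.
  rewrite -law_Nyo; apply: law_Nyo_le => a /(sup_gt (ex_intro _ 0 S0))[b Sb /ltW ab].
  exact: le_trans (mono _ _ ab) Sb.
have : (rho `]sup S, +oo[%classic <= 1 - c%:E)%E.
  apply: law_oy_le => a ha; rewrite law_oy -EFinB.
  rewrite -(fineK (law_Nyc_fin a)) -EFinB lee_fin lerD2l lerN2.
  rewrite -lee_fin fineK ?law_Nyc_fin// leNgt; apply/negP => /ltW Sa.
  by have := sup_upper_bound supS Sa; rewrite leNgt ha.
rewrite law_oy -EFinB -(fineK (law_Nyc_fin _)) -EFinB !lee_fin; lra.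
Qed.

Lemma quantile_unique (c : R) a b : 0 < c ->
  rho `]-oo, a]%classic = c%:E -> rho `]-oo, b]%classic = c%:E -> a = b.
Proof.
move=> c0.
have gt0 z : rho `]-oo, z]%classic = c%:E -> 0 < z.
  move=> hz; rewrite ltNge; apply/negP => /law_Nyc_eq0; rewrite hz => /eqP.
  by rewrite eqe gt_eqF.
move=> ha hb; have [ab|ab|//] := ltgtP a b.
  suff : (c%:E < c%:E)%E by rewrite ltxx.
  by rewrite -{1}ha -hb; apply: law_Nyc_lt; rewrite ab ltW// gt0.
suff : (c%:E < c%:E)%E by rewrite ltxx.
by rewrite -{1}hb -ha; apply: law_Nyc_lt; rewrite ab ltW// gt0.
Qed.

(** In both applications [pY] depends on [b] through its square, so the opposite of the critical
    value also solves [pY b = alpha]. The equation [pZ b = pY b] discards it, since [pZ b] is 1 for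
    negative [b]. *)
Lemma critical_value_characterization (cover pZ pY : R -> \bar R) (alpha : R) :
  0 < alpha < 1 ->
  (forall b, cover b = rho `]-oo, b]%classic) -> (forall b, pZ b = rho `[b, +oo[%classic) ->
  (forall b, 0 <= b -> pZ b = pY b) ->
  [/\ exists! b, is_critical_value cover alpha b,
      forall b, 0 <= b -> pZ b = pY b &
      forall b, is_critical_value cover alpha b <->
        pZ b = pY b /\ pY b = alpha%:E].
Proof.
move=> /andP[a0 a1] hcover hZ hZY; rewrite /is_critical_value.
have a'0 : 0 < 1 - alpha by lra.
split=> //.
  have [|b hb] := @quantile_exists (1 - alpha); first by lra.
  exists b; split; first by rewrite hcover hb.
  by move=> b'; rewrite hcover => hb'; exact: quantile_unique hb hb'.
move=> b; split.
  rewrite hcover => hb.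
  have b0 : 0 <= b.
    rewrite leNgt; apply/negP => /ltW /law_Nyc_eq0; rewrite hb => /eqP.
    by rewrite eqe gt_eqF.
  rewrite -hZY//; split => //; rewrite hZ law_cy hb -EFinB; congr EFin; lra.
case=> <-; rewrite hZ law_cy hcover -{1 2}(fineK (law_Nyc_fin b)) -!EFinB => -[] hb.
by congr EFin; lra.
Qed.

End properties.
End critical_value.

(** * Division by an independent random scale *)

Lemma measurable_sqrt (R : realType) : measurable_fun setT (@Num.sqrt R).
Proof. by apply: continuous_measurable_fun; exact: sqrt_continuous. Qed.

Section ratio_law.
Context {R : realType} (kap mu : probability R R).
Hypothesis kap0 : kap `]-oo, 0]%classic = 0%E.
Hypothesis muP : continuous_positive_law mu.

Lemma product_measure_eq_pos (E F : set (R * R)) : measurable E -> measurable F ->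
  (forall t, 0 < t -> mu (xsection E t) = mu (xsection F t)) ->
  (kap \x mu)%E E = (kap \x mu)%E F.
Proof.
move=> mE mF EF; apply: ge0_ae_eq_integral => //.
- exact: measurable_fun_xsection.
- exact: measurable_fun_xsection.
- exists `]-oo, 0]%classic; split => // t /= h.
  rewrite in_itv/= leNgt; apply/negP => t0; apply: h => _.
  exact: EF.
Qed.

Lemma product_measure_gt0_pos (E : set (R * R)) : measurable E ->
  (forall t, 0 < t -> (0 < mu (xsection E t))%E) -> (0 < (kap \x mu)%E E)%E.
Proof.
move=> mE Epos; rewrite lt0e measure_ge0 andbT; apply/negP => /eqP E0.
have : ae_eq kap setT (mu \o xsection E) (cst 0%E).
  apply/ae_eq_integral_abs => //; first exact: measurable_fun_xsection.
  rewrite -[RHS]E0; apply: eq_integral => t _.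
  by rewrite gee0_abs//; exact: measure_ge0.
move=> [M [mM M0 EM]].
have : kap setT = 0%E.
  apply: measure_negligible => //.
  apply: (@negligibleS _ _ _ kap (`]-oo, 0]%classic `|` M)); last first.
    by apply: negligibleU; apply/negligibleP.
  move=> t _ /=; rewrite in_itv/=; have [t0|t0] := leP t 0; [by left|right].
  by apply: EM => /= /(_ Logic.I) h; have := Epos _ t0; rewrite h ltxx.
by rewrite probability_setT => /eqP; rewrite onee_eq0.
Qed.

(** [m / sqrt t] written as a power: measurable on the whole plane, and equal to the quotient for
    [t > 0], where [kap] has all its mass. *)
Let ratio (p : R * R) : R := p.2 * p.1 `^ (- 2^-1).

Let ratioE t m : 0 < t -> ratio (t, m) = m / Num.sqrt t.
Proof. by move=> t0; rewrite /ratio/= powRN powR12_sqrt// ltW. Qed.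

Let measurable_ratio : measurable_fun setT ratio.
Proof.
apply: measurable_funM; first exact: measurable_snd.
exact: (measurableT_comp (measurable_powR (- 2^-1 : R)) measurable_fst).
Qed.

Let ratio_rv : {RV (kap \x mu)%E >-> R} :=
  HB.pack ratio (isMeasurableFun.Build _ _ _ _ _ measurable_ratio).

Lemma measurable_le_sqrt (b : R) :
  measurable [set p : R * R | p.2 <= b * Num.sqrt p.1].
Proof.
rewrite -[X in measurable X]setTI; apply: measurable_fun_le => //.
apply: measurable_funM => //.
exact: (measurableT_comp (@measurable_sqrt R) measurable_fst).
Qed.

Lemma measurable_ge_sqrt (b : R) :
  measurable [set p : R * R | b * Num.sqrt p.1 <= p.2].
Proof.
rewrite -[X in measurable X]setTI; apply: measurable_fun_le => //.
apply: measurable_funM => //.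
exact: (measurableT_comp (@measurable_sqrt R) measurable_fst).
Qed.

(** For fixed [t > 0] an event on the ratio is an event on [m] with endpoints multiplied by
    [sqrt t]; integrating over [t] transfers the absence of atoms and the positivity on intervals
    from [mu] to [rho]. *)
Lemma ratio_law : exists rho : probability R R,
  [/\ continuous_positive_law rho,
      forall b, (kap \x mu)%E [set p | p.2 <= b * Num.sqrt p.1] =
        rho `]-oo, b]%classic &
      forall b, (kap \x mu)%E [set p | b * Num.sqrt p.1 <= p.2] =
        rho `[b, +oo[%classic].
Proof.
have [at0 itvpos mu0] := muP.
have mpre B : measurable B -> measurable (ratio @^-1` B).
  by move=> mB; rewrite -[X in measurable X]setTI; exact: measurable_ratio.
exists (distribution (kap \x mu)%E ratio_rv); split; first split.
- move=> b; rewrite -(measure0 (kap \x mu)%E).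
  apply: (product_measure_eq_pos (mpre _ (measurable_set1 b)) measurable0).
  move=> t t0; rewrite xsection0 measure0 -(at0 (b * Num.sqrt t)).
  congr (mu _); apply/seteqP; rewrite /xsection; split => m /=; rewrite inE /= ratioE//.
    by move=> <-; rewrite divfK// gt_eqF// sqrtr_gt0.
  by move=> ->; rewrite mulfK// gt_eqF// sqrtr_gt0.
- move=> a b /andP[a0 ab]; apply: (product_measure_gt0_pos (mpre _ (measurable_itv _))).
  move=> t t0; have st0 : 0 < Num.sqrt t by rewrite sqrtr_gt0.
  have -> : xsection (ratio @^-1` `]a, b[) t =
      `]a * Num.sqrt t, b * Num.sqrt t[%classic.
    apply/seteqP; rewrite /xsection.
    by split => m /=; rewrite inE /= !in_itv/= ratioE// ltr_pdivlMr// ltr_pdivrMr.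
  by apply: itvpos; rewrite ltr_pM2r// ab mulr_ge0// ltW.
- rewrite -(measure0 (kap \x mu)%E).
  apply: (product_measure_eq_pos (mpre _ (measurable_itv _)) measurable0).
  move=> t t0; rewrite xsection0 measure0 -mu0.
  congr (mu _); apply/seteqP; rewrite /xsection.
  by split => m /=; rewrite inE /= !in_itv/= ratioE// pmulr_lle0// invr_gt0 sqrtr_gt0.
- move=> b; apply: (product_measure_eq_pos (measurable_le_sqrt b) (mpre _ (measurable_itv _))).
  move=> t t0; congr (mu _); apply/seteqP; rewrite /xsection.
  by split => m /=; rewrite !inE /= in_itv/= ratioE// ler_pdivrMr// sqrtr_gt0.
- move=> b; apply: (product_measure_eq_pos (measurable_ge_sqrt b) (mpre _ (measurable_itv _))).
  move=> t t0; congr (mu _); apply/seteqP; rewrite /xsection.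
  by split => m /=; rewrite !inE /= in_itv/= andbT ratioE// ler_pdivlMr// sqrtr_gt0.
Qed.

End ratio_law.

(** * Conditional probabilities *)

Section conditional_probability.
Context d (T : measurableType d) (R : realType) (P : probability T R).

Section restricted_law.
Variables (A : set T) (mA : measurable A) (X : {RV P >-> R}).

Definition restricted_law : set R -> \bar R := pushforward (mrestr P mA) X.

Let restricted_law0 : restricted_law set0 = 0%E.
Proof. exact: measure0. Qed.

Let restricted_law_ge0 B : (0 <= restricted_law B)%E.
Proof. exact: measure_ge0. Qed.

Let restricted_law_sigma_additive : semi_sigma_additive restricted_law.
Proof. exact: measure_semi_sigma_additive. Qed.

HB.instance Definition _ := isMeasure.Build _ _ _ restricted_law
  restricted_law0 restricted_law_ge0 restricted_law_sigma_additive.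

Let restricted_law_fin : fin_num_fun restricted_law.
Proof.
move=> B mB; rewrite ge0_fin_numE//.
rewrite /restricted_law /pushforward /= /mrestr.
apply: le_lt_trans (ltry 1); apply: probability_le1; apply: measurableI => //.
by rewrite -[X in measurable X]setTI; exact: measurable_funP.
Qed.

HB.instance Definition _ :=
  Measure_isFinite.Build _ _ _ restricted_law restricted_law_fin.

Lemma restricted_law_dominated : restricted_law `<< distribution P X.
Proof.
apply/null_content_dominatesP => B mB B0.
have mXB : measurable (X @^-1` B).
  by rewrite -[X in measurable X]setTI; exact: measurable_funP.
apply/eqP; rewrite -measure_le0 -B0.
apply: (@le_measure _ _ _ P); rewrite ?inE//; exact: measurableI.
Qed.

End restricted_law.

(* The Radon-Nikodym derivative of the law of [X] restricted to [A], composed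
   with [X]. *)
Lemma is_cond_prob_exists (A : set T) (X : {RV P >-> R}) : measurable A ->
  exists g, is_cond_prob P (sigma_rv X) A g.
Proof.
move=> mA.
have [f [f0 ffin fint fE]] := radon_nikodym_sigma_finite (@restricted_law_dominated A mA X).
have mff : measurable_fun setT (fine \o f).
  by apply: measurableT_comp => //; exact: measurable_int fint.
have fineE (w : R) : (fine (f w))%:E = f w by rewrite fineK.
exists (fine \o f \o X); split.
- move=> B mB; exists ((fine \o f) @^-1` B); last by rewrite setTI.
  by rewrite -[X in measurable X]setTI; exact: mff.
- apply/integrableP; split.
    apply/measurable_EFinP; exact: measurableT_comp.
  have /integrableP[_] := fint.
  rewrite (ge0_integral_distribution X (f := fun w => `|f w|%E))//; last first.
    by apply: measurableT_comp => //; exact: measurable_int fint.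
  by apply: le_lt_trans; rewrite le_eqVlt; apply/orP; left; apply/eqP;
    apply: eq_integral => w _; congr (`|_|%E); exact: fineE.
- move=> _ [B mB <-]; rewrite setTI.
  rewrite setIC -[RHS]/(restricted_law mA X B) fE//.
  have mfB : measurable_fun B f by apply: measurable_funTS; exact: measurable_int fint.
  have := ge0_integral_pushforward (measurable_funP X) P mB mfB (fun w _ => f0 w).
  by move=> ->; apply: eq_integral => w _; rewrite /= fineE.
Qed.

(** The defining identity of a version, taken over the whole space. Existence of a version ensures
    that the choice in [cond_prob] does not fall back on its default 0. *)
Lemma expectation_cond_prob (A : set T) (X : {RV P >-> R}) : measurable A ->
  'E_P[cond_prob P A X]%E = P A.
Proof.
move=> mA; rewrite /cond_prob.
case: xgetP => [g _ [_ _ gA]|no]; last first.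
  by have [g hg] := is_cond_prob_exists X mA; case: (no g).
rewrite unlock gA ?setIT//.
by exists setT => //; rewrite setTI preimage_setT.
Qed.

End conditional_probability.

(** * Support functions and contrasts *)

Section support_function.
Context {R : realType} {J : finType}.
Implicit Types (A : set (J -> R)) (y : J -> R).

Definition support_fun A y : R := sup [set \sum_j a j * y j | a in A].

Variable A : set (J -> R).
Hypothesis A_bounded : forall a, A a -> forall j, `|a j| <= 1.
Hypothesis A_sym : forall a, A a -> A (fun j => - a j).
Hypothesis A_neq0 : exists2 a, A a & exists j, a j != 0.

Lemma support_fun_has_sup y : has_sup [set \sum_j a j * y j | a in A].
Proof.
split; first by have [a Aa _] := A_neq0; exists (\sum_j a j * y j), a.
exists (\sum_j `|y j|) => _ [a Aa <-].
apply: ler_sum => j _; apply: le_trans (ler_norm _) _.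
by rewrite normrM ler_piMl// A_bounded.
Qed.

Lemma support_fun_ge y a : A a -> \sum_j a j * y j <= support_fun A y.
Proof. by move=> Aa; apply: sup_upper_bound; [exact: support_fun_has_sup|exists a]. Qed.

Lemma support_fun_leP y c :
  support_fun A y <= c <-> forall a, A a -> \sum_j a j * y j <= c.
Proof.
split=> [h a Aa|h]; first exact: le_trans (support_fun_ge y Aa) h.
apply: ge_sup; first by case: (support_fun_has_sup y).
by move=> _ [a Aa <-]; exact: h.
Qed.

Let support_fun_homW c y : support_fun A (fun j => c * y j) <= `|c| * support_fun A y.
Proof.
apply/support_fun_leP => a Aa.
have [c0|/ltW c0] := leP 0 c.
  rewrite ger0_norm//; under eq_bigr do rewrite mulrCA.
  by rewrite -mulr_sumr ler_wpM2l// support_fun_ge.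
rewrite ler0_norm//.
under eq_bigr do rewrite mulrCA -[c * _]opprK -mulNr -mulrN -mulNr.
by rewrite -mulr_sumr ler_wpM2l ?oppr_ge0// support_fun_ge//; exact: A_sym.
Qed.

(** Symmetry of [A] bounds the value at [c y] by [|c|] times that at [y] for negative [c] too; the
    reverse inequality is the same bound for [c^-1], with [c = 0] apart. *)
Lemma support_fun_seminorm : seminorm (support_fun A).
Proof.
split=> [x y|c y].
  apply/support_fun_leP => a Aa; under eq_bigr do rewrite mulrDr.
  by rewrite big_split/= lerD// support_fun_ge.
apply/eqP; rewrite eq_le support_fun_homW /=.
have [->|c0] := eqVneq c 0.
  rewrite normr0 mul0r; have [a Aa _] := A_neq0.
  apply: le_trans (support_fun_ge _ Aa).
  by rewrite big1// => j _; rewrite mul0r mulr0.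
have := support_fun_homW c^-1 (fun j => c * y j).
under [X in support_fun A X <= _ -> _]eq_fun do rewrite mulKf//.
by rewrite normfV mulrC ler_pdivlMr ?normr_gt0// mulrC.
Qed.

Lemma support_fun_neq0 : exists v, support_fun A v != 0.
Proof.
have [a Aa [j aj]] := A_neq0; exists a; rewrite gt_eqF//.
apply: lt_le_trans (support_fun_ge _ Aa).
rewrite (bigD1 j)//= ltr_pwDl//; first by rewrite -expr2 exprn_even_gt0.
by apply: sumr_ge0 => i _; rewrite -expr2 sqr_ge0.
Qed.

End support_function.

(** * Euclidean geometry and orthonormal contrasts *)

Section linear_algebra.
Context {R : realType}.

Lemma dotE m (u v : 'cV[R]_m) : dot u v = \sum_i u i 0 * v i 0.
Proof. by rewrite /dot mxE; apply: eq_bigr => i _; rewrite mxE. Qed.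

Lemma dotC m (u v : 'cV[R]_m) : dot u v = dot v u.
Proof. by rewrite !dotE; apply: eq_bigr => i _; rewrite mulrC. Qed.

Lemma dotDl m (u v w : 'cV[R]_m) : dot (u + v) w = dot u w + dot v w.
Proof. by rewrite /dot linearD mulmxDl mxE. Qed.

Lemma dotZl m a (u v : 'cV[R]_m) : dot (a *: u) v = a * dot u v.
Proof. by rewrite /dot linearZ /= -scalemxAl mxE. Qed.

Lemma dotNl m (u v : 'cV[R]_m) : dot (- u) v = - dot u v.
Proof. by rewrite -scaleN1r dotZl mulN1r. Qed.

Lemma dotBl m (u v w : 'cV[R]_m) : dot (u - v) w = dot u w - dot v w.
Proof. by rewrite dotDl -scaleN1r dotZl mulN1r. Qed.

Lemma dotZr m a (u v : 'cV[R]_m) : dot u (a *: v) = a * dot u v.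
Proof. by rewrite dotC dotZl dotC. Qed.

Lemma dot_ge0 m (u : 'cV[R]_m) : 0 <= dot u u.
Proof. by rewrite dotE; apply: sumr_ge0 => i _; rewrite -expr2 sqr_ge0. Qed.

Lemma dot_eq0 m (u : 'cV[R]_m) : dot u u = 0 -> u = 0.
Proof.
rewrite dotE => /eqP; rewrite psumr_eq0; last by move=> i _; rewrite -expr2 sqr_ge0.
move=> /allP h; apply/matrixP => i j; rewrite (ord1 j) mxE.
by have := h i (mem_index_enum _); rewrite /= mulf_eq0 orbb => /eqP.
Qed.

Lemma sqr_l2norm m (u : 'cV[R]_m) : l2norm u ^+ 2 = dot u u.
Proof. by rewrite /l2norm sqr_sqrtr// dot_ge0. Qed.

Lemma l2norm_gt0 m (u : 'cV[R]_m) : u != 0 -> 0 < l2norm u.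
Proof.
move=> u0; rewrite /l2norm sqrtr_gt0 lt_neqAle dot_ge0 andbT eq_sym.
by apply: contra u0 => /eqP/dot_eq0 ->.
Qed.

Lemma l2norm_normalize m (u : 'cV[R]_m) : u != 0 -> l2norm ((l2norm u)^-1 *: u) = 1.
Proof.
move=> /l2norm_gt0 u0; rewrite {1}/l2norm dotZl dotZr -sqr_l2norm mulrA -invfM.
by rewrite -expr2 mulVf ?sqrtr1// expf_neq0// gt_eqF.
Qed.

Lemma unit_sphere_dot m (u : 'cV[R]_m) : unit_sphere u -> dot u u = 1.
Proof. by rewrite /unit_sphere /= => u1; rewrite -sqr_l2norm u1 expr1n. Qed.

Lemma unit_sphere_coord_le1 m (u : 'cV[R]_m) i : unit_sphere u -> `|u i 0| <= 1.
Proof.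
move=> /unit_sphere_dot; rewrite dotE (bigD1 i)//= => u1.
rewrite -(@ler_pXn2r _ 2)// ?nnegrE// expr1n -normrX ger0_norm ?sqr_ge0// expr2 -u1.
by rewrite lerDl; apply: sumr_ge0 => j _; rewrite -expr2 sqr_ge0.
Qed.

Lemma unit_sphereN m (u : 'cV[R]_m) : unit_sphere u -> unit_sphere (- u).
Proof.
by rewrite /unit_sphere /= /l2norm -scaleN1r dotZl dotZr mulrA mulrNN !mul1r.
Qed.

Lemma unit_sphere_neq0 m (u : 'cV[R]_m) : unit_sphere u -> exists i, u i 0 != 0.
Proof.
move=> /unit_sphere_dot u1; apply: contrapT => h.
have u0 : u = 0.
  apply/matrixP => i j; rewrite (ord1 j) mxE; apply/eqP; apply: contrapT => /negP ui.
  by apply: h; exists i.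
by move: u1; rewrite u0 /dot mulmx0 mxE => /eqP; rewrite eq_sym oner_eq0.
Qed.

(** Cauchy-Schwarz, from the squared norm of [v] minus its projection on [h]. *)
Lemma dot_unit_sphere_le m (h v : 'cV[R]_m) : unit_sphere h ->
  dot h v ^+ 2 <= dot v v.
Proof.
move=> /unit_sphere_dot h1; have := dot_ge0 (v - dot h v *: h).
rewrite dotBl dotZl [dot v (_ - _)]dotC [dot h (_ - _)]dotC !dotBl !dotZl h1 [dot v h]dotC.
by rewrite mulr1 subrr mulr0 subr0 subr_ge0 expr2.
Qed.

(* Householder reflection exchanging [u] and the first basis vector; when they
   coincide the division by zero makes it the identity. *)
Lemma orthogonal_completion n (u : 'cV[R]_n.+1) : dot u u = 1 ->
  exists H : 'M[R]_n.+1, [/\ H *m H^T = 1%:M & forall i, H ord0 i = u i 0].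
Proof.
move=> u1.
pose e : 'cV[R]_n.+1 := delta_mx ord0 0.
pose v := u - e; pose q := dot v v.
pose H := 1%:M - (2 / q) *: (v *m v^T).
have vv : v^T *m v = q%:M by apply/matrixP => i j; rewrite !ord1 !mxE eqxx mulr1n /q /dot mxE.
have HT : H^T = H.
  by rewrite /H linearB linearZ /= trmx1 trmx_mul trmxK.
have ue : dot u e = u ord0 0.
  rewrite dotE (bigD1 ord0)//= big1 ?addr0 ?mxE ?eqxx ?mulr1// => i /negbTE i0.
  by rewrite mxE i0 mulr0.
have ee : dot e e = 1.
  rewrite dotE (bigD1 ord0)//= big1 ?addr0 ?mxE ?eqxx ?mulr1// => i /negbTE i0.
  by rewrite mxE i0 mulr0.
have qE : q = 2 * (1 - u ord0 0).
  rewrite /q /v dotBl [dot u _]dotC [dot e (_ - _)]dotC !dotBl u1 ee [dot e u]dotC ue; ring.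
have HH : H *m H = 1%:M.
  rewrite /H mulmxBl mulmxBr mulmx1 mul1mx mulmxBr mulmx1 -!scalemxAl -!scalemxAr.
  rewrite mulmxA -[v *m v^T *m v]mulmxA vv mul_mx_scalar -scalemxAl !scalerA.
  have [q0|q0] := eqVneq q 0; first by rewrite q0 invr0 mulr0 !mul0r !scale0r !subr0.
  rewrite divfK// [_ / _ * 2]mulr_natr -scalerMnl [_ *: _ *+ 2]mulr2n.
  by rewrite opprD opprK addKr subrK.
have Hu : H *m u = e.
  rewrite /H mulmxBl mul1mx -scalemxAl -mulmxA.
  have -> : v^T *m u = (1 - u ord0 0)%:M.
    apply/matrixP => i j; rewrite !ord1 [RHS]mxE eqxx mulr1n -/(dot v u) /v dotBl u1.
    by rewrite dotC ue.
  rewrite mul_mx_scalar scalerA.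
  have [q0|q0] := eqVneq q 0.
    rewrite q0 invr0 mulr0 mul0r scale0r subr0.
    by have := dot_eq0 q0 => /eqP; rewrite subr_eq0 => /eqP.
  have -> : 2 / q * (1 - u ord0 0) = 1.
    by rewrite mulrAC -qE divff.
  by rewrite scale1r /v subKr.
exists H; split; first by rewrite HT HH.
move=> i.
have -> : u i 0 = (H *m e) i 0 by rewrite -Hu mulmxA HH mul1mx.
clearbody H; rewrite mxE (bigD1 ord0)//= big1 ?addr0.
  by rewrite -[in LHS]HT !mxE eqxx mulr1.
by move=> j /negbTE j0; rewrite [X in _ * X]mxE j0 mulr0.
Qed.

(** After division by [s i = sqrt (r i)], contrasts become the vectors orthogonal to [u], which is
    proportional to [s]. In an orthogonal matrix with first row [u] the other rows are an
    orthonormal basis of that hyperplane; multiplying them back by [s] gives [C]. *)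
Lemma contrast_basis k (r : 'I_k -> nat) : (0 < k)%N -> (forall i, (0 < r i)%N) ->
  exists C : 'I_k.-1 -> 'I_k -> R,
  [/\ forall a, \sum_i C a i = 0,
      forall a b, \sum_i C a i * C b i / (r i)%:R = (a == b)%:R &
      forall c : 'I_k -> R, \sum_i c i = 0 ->
        exists h : 'I_k.-1 -> R, forall i, c i = \sum_a h a * C a i].
Proof.
case: k r => [//|n] r _ r0; rewrite [n.+1.-1]/=; pose s i : R := Num.sqrt (r i)%:R.
have s0 i : 0 < s i by rewrite sqrtr_gt0 ltr0n.
have ss i : s i ^+ 2 = (r i)%:R by rewrite sqr_sqrtr.
pose T : R := \sum_i (r i)%:R.
have T0 : 0 < T by rewrite /T (bigD1 ord0)//= ltr_pwDl ?ltr0n// sumr_ge0.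
pose u : 'cV[R]_n.+1 := \col_i (s i / Num.sqrt T).
have u1 : dot u u = 1.
  rewrite dotE; under eq_bigr do rewrite mxE -expr2 expr_div_n ss sqr_sqrtr ?(ltW T0)//.
  by rewrite -mulr_suml divff// gt_eqF.
have [H [HHT H0]] := orthogonal_completion u1.
have HTH : H^T *m H = 1%:M by exact: mulmx1C.
have rows a b : \sum_i H a i * H b i = (a == b)%:R.
  have := congr1 (fun M : 'M[R]_n.+1 => M a b) HHT; rewrite !mxE => <-.
  by apply: eq_bigr => i _; rewrite mxE.
have cols a b : \sum_i H i a * H i b = (a == b)%:R.
  have := congr1 (fun M : 'M[R]_n.+1 => M a b) HTH; rewrite !mxE => <-.
  by apply: eq_bigr => i _; rewrite mxE.
have sH i : s i = Num.sqrt T * H ord0 i.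
  by rewrite H0 mxE mulrC divfK// gt_eqF// sqrtr_gt0.
exists (fun a i => H (lift ord0 a) i * s i); split.
- move=> a; under eq_bigr do rewrite sH mulrCA.
  by rewrite -mulr_sumr rows eq_sym (negbTE (neq_lift _ _)) mulr0.
- move=> a b; rewrite -(inj_eq (@lift_inj _ ord0)) -rows; apply: eq_bigr => i _.
  by rewrite mulrACA -expr2 ss mulfK// pnatr_eq0 -lt0n.
- move=> c c0.
  exists (fun a => \sum_i H (lift ord0 a) i * (c i / s i)) => i.
  pose x i := c i / s i.
  have Hx0 : \sum_i H ord0 i * x i = 0.
    have st0 : Num.sqrt T != 0 by rewrite gt_eqF// sqrtr_gt0.
    apply: (mulfI st0); rewrite mulr0 mulr_sumr -[RHS]c0; apply: eq_bigr => j _.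
    by rewrite mulrA -sH /x mulrC divfK// gt_eqF.
  have xE : x i = \sum_a (\sum_j H a j * x j) * H a i.
    under eq_bigr do rewrite mulr_suml.
    rewrite exchange_big/= (bigD1 i)//= [X in _ + X]big1 ?addr0.
      under eq_bigr do rewrite mulrAC.
      by rewrite -mulr_suml cols eqxx mul1r.
    move=> j ji; under eq_bigr do rewrite mulrAC.
    by rewrite -mulr_suml cols (negbTE ji) mul0r.
  have -> : c i = x i * s i by rewrite /x divfK// gt_eqF.
  rewrite xE big_ord_recl Hx0 mul0r add0r mulr_suml.
  by apply: eq_bigr => a _; rewrite mulrA.
Qed.

End linear_algebra.

(** * The Gaussian field and the chi-square process as a support function and its square *)

Section field.
Context {R : realType} (m p : nat) (X : set R) (f : R -> 'cV[R]_p) (S : 'M[R]_p).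
Hypothesis m0 : (0 < m)%N.
Hypothesis X0 : X !=set0.
Hypothesis Sf0 : forall t, X t -> S *m f t != 0.

Definition field_coef (t : R) (h : 'cV[R]_m) (j : 'I_m * 'I_p) : R :=
  h j.1 0 * psi f S t j.2 0.

Definition field_coefs : set ('I_m * 'I_p -> R) :=
  [set field_coef t h | t in X & h in @unit_sphere R m].

Lemma psi_unit t : X t -> unit_sphere (psi f S t).
Proof. by move=> Xt; exact: l2norm_normalize (Sf0 Xt). Qed.

Lemma delta_unit (i : 'I_m) : unit_sphere (delta_mx i 0 : 'cV[R]_m).
Proof.
rewrite /unit_sphere /= /l2norm dotE (bigD1 i)//= big1 ?addr0.
  by rewrite mxE !eqxx mulr1 sqrtr1.
by move=> j /negbTE ji; rewrite mxE ji mul0r.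
Qed.

Lemma field_coefs_bounded a : field_coefs a -> forall j, `|a j| <= 1.
Proof.
move=> [t Xt [h h1 <-]] j; rewrite /field_coef normrM mulr_ile1//.
  exact: unit_sphere_coord_le1.
exact: unit_sphere_coord_le1 (psi_unit Xt).
Qed.

Lemma field_coefs_sym a : field_coefs a -> field_coefs (fun j => - a j).
Proof.
move=> [t Xt [h h1 <-]]; exists t => //; exists (- h); first exact: unit_sphereN.
by apply/funext => j; rewrite /field_coef mxE mulNr.
Qed.

Lemma field_coefs_neq0 : exists2 a, field_coefs a & exists j, a j != 0.
Proof.
have [t Xt] := X0; pose i0 := Ordinal m0.
have [l l0] := unit_sphere_neq0 (psi_unit Xt).
exists (field_coef t (delta_mx i0 0)).
  by exists t => //; exists (delta_mx i0 0) => //; exact: delta_unit.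
by exists (i0, l); rewrite /field_coef /= mxE !eqxx mul1r.
Qed.

Definition field_norm : ('I_m * 'I_p -> R) -> R := support_fun field_coefs.

Lemma field_norm_seminorm : seminorm field_norm.
Proof.
exact: support_fun_seminorm field_coefs_bounded field_coefs_sym field_coefs_neq0.
Qed.

Lemma field_norm_neq0 : exists v, field_norm v != 0.
Proof. exact: support_fun_neq0 field_coefs_bounded field_coefs_neq0. Qed.

Lemma field_norm_leP y c : field_norm y <= c <->
  forall t h, X t -> unit_sphere h -> \sum_j field_coef t h j * y j <= c.
Proof.
rewrite /field_norm (support_fun_leP field_coefs_bounded field_coefs_neq0); split.
  by move=> hc t h Xt h1; apply: hc; exists t => //; exists h.
by move=> hc _ [t Xt [h h1 <-]]; exact: hc.
Qed.

Lemma field_coef_sum t h y : \sum_j field_coef t h j * y j =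
  dot h (\col_i \sum_l y (i, l) * psi f S t l 0).
Proof.
rewrite dotE; transitivity (\sum_i \sum_l field_coef t h (i, l) * y (i, l)).
  by rewrite pair_bigA; apply: eq_bigr => -[].
apply: eq_bigr => i _; rewrite mxE mulr_sumr; apply: eq_bigr => l _.
by rewrite /field_coef/= -mulrA [psi _ _ _ _ _ * _]mulrC.
Qed.

Context (Omega : Type) (xi : 'I_m -> 'I_p -> Omega -> R).
Let xiv (w : Omega) (j : 'I_m * 'I_p) : R := xi j.1 j.2 w.

Lemma ZfieldE t h w : Zfield f S xi t h w = \sum_j field_coef t h j * xiv w j.
Proof.
rewrite /Zfield dotE (reindex (@mxtens_index m p)) /=; last first.
  by exists (@mxtens_unindex m p) => j _; rewrite ?mxtens_indexK ?mxtens_unindexK.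
apply: eq_bigr => j _; rewrite [xi_stack _ _ _ _]mxE mxtens_indexK [xi_vec _ _ _ _ _]mxE.
rewrite mulrC; congr (_ * _); rewrite [LHS]mxE mxtens_indexK /field_coef.
by congr (h _ _ * psi f S t _ _); exact: ord1.
Qed.

Lemma YprocE t w : Yproc f S xi t w =
  dot (\col_i \sum_l xiv w (i, l) * psi f S t l 0)
      (\col_i \sum_l xiv w (i, l) * psi f S t l 0).
Proof.
rewrite dotE /Yproc; apply: eq_bigr => i _; rewrite !mxE expr2 !dotE.
by congr (_ * _); apply: eq_bigr => l _; rewrite mxE.
Qed.

Lemma maxZE w : maxZ X f S xi w = (field_norm (xiv w))%:E.
Proof.
rewrite -ereal_sup_EFin; last 2 first.
- by have [] := support_fun_has_sup field_coefs_bounded field_coefs_neq0 (xiv w).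
- by have [] := support_fun_has_sup field_coefs_bounded field_coefs_neq0 (xiv w).
congr ereal_sup; apply/seteqP; split.
  move=> _ [t Xt [h h1 <-]]; rewrite ZfieldE.
  exists (\sum_j field_coef t h j * xiv w j) => //.
  by exists (field_coef t h) => //; exists t => //; exists h.
by move=> _ [_ [_ [t Xt [h h1 <-]] <-] <-]; exists t => //; exists h => //; rewrite ZfieldE.
Qed.

(** [Z(t, h)] is the inner product of [h] with a vector whose squared norm is [Y(t)]; the optimal
    unit [h] is that vector normalized. *)
Lemma maxYE w : maxY X f S xi w = (field_norm (xiv w) ^+ 2)%:E.
Proof.
have N0 := seminorm_ge0 field_norm_seminorm (xiv w).
apply/eqP; rewrite eq_le; apply/andP; split.
  apply: ge_ereal_sup => _ [t Xt <-]; rewrite lee_fin YprocE.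
  set v := \col_i _.
  have [->|v0] := eqVneq v 0; first by rewrite /dot mulmx0 mxE sqr_ge0.
  have /field_norm_leP/(_ t ((l2norm v)^-1 *: v) Xt) := lexx (field_norm (xiv w)).
  rewrite field_coef_sum -/v dotZl -sqr_l2norm => /(_ (l2norm_normalize v0)).
  have v1 := l2norm_gt0 v0.
  rewrite expr2 mulKf ?gt_eqF// => hv.
  by rewrite -expr2 ler_pXn2r ?nnegrE// ltW.
have [t0 Xt0] := X0.
have Yle t : X t -> ((Yproc f S xi t w)%:E <= maxY X f S xi w)%E.
  by move=> Xt; apply: ereal_sup_ubound; exists t.
case: (maxY X f S xi w) Yle => [s| |] Yle; last 2 first.
- by rewrite leey.
- by have := Yle _ Xt0; rewrite leNgt ltNyr.
have s0 : 0 <= s.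
  have := Yle _ Xt0; rewrite lee_fin; apply: le_trans; rewrite YprocE; exact: dot_ge0.
rewrite lee_fin -(sqr_sqrtr s0) ler_pXn2r ?nnegrE ?sqrtr_ge0//.
apply/field_norm_leP => t h Xt h1; rewrite field_coef_sum.
apply: le_trans (ler_norm _) _; rewrite -sqrtr_sqr ler_wsqrtr//.
apply: le_trans (dot_unit_sphere_le _ h1) _.
by have := Yle _ Xt; rewrite lee_fin YprocE.
Qed.

End field.

(** * Weighted least squares *)

Section weighted_least_squares.
Context {R : realType} (k p n : nat) (r : 'I_k -> nat) (X : set R)
  (f : R -> 'cV[R]_p) (x : 'I_n -> R) (beta : 'I_k -> 'cV[R]_p).

Lemma linear_coef_eq0 (A B : R) : (forall t, 0 <= t ^+ 2 * B - 2 * t * A) ->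
  0 <= B -> A = 0.
Proof.
move=> h B0; apply/eqP; apply: contrapT => /negP A0.
have B1 : 0 < B + 1 by lra.
(* The minimizer [A / B] with [B + 1] in place of [B], which also covers [B = 0]; the value is still
   negative unless [A = 0]. *)
have := h (A / (B + 1)).
have -> : (A / (B + 1)) ^+ 2 * B - 2 * (A / (B + 1)) * A =
    - (A ^+ 2 * (B + 2) / (B + 1) ^+ 2) by field; rewrite gt_eqF.
rewrite oppr_ge0 leNgt divr_gt0 ?exprn_gt0// mulr_gt0//; last by lra.
by rewrite exprn_even_gt0.
Qed.

(** First-order optimality: replacing [b] by [b + t v] changes the weighted sum of squares by
    [t ^+ 2 * B - 2 * t * A], where [A] is the sum that must vanish. *)
Lemma wls_normal_equation (wsd : R -> R) m (y : 'I_n -> 'I_m -> R) (b : 'cV[R]_p) :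
  is_wls f x wsd y b -> forall v : 'cV[R]_p,
  \sum_(j < n) \sum_(h < m) wsd (x j) ^- 2 * (y j h - dot b (f (x j))) *
    dot v (f (x j)) = 0.
Proof.
move=> wls v.
apply: (@linear_coef_eq0 _ (\sum_(j < n) \sum_(h < m) wsd (x j) ^- 2 *
    dot v (f (x j)) ^+ 2)); last first.
  by do 2 (apply: sumr_ge0 => ? _); rewrite mulr_ge0 ?invr_ge0 ?sqr_ge0.
move=> t; have := wls (b + t *: v); rewrite /is_wls -subr_ge0.
congr (0 <= _); rewrite -sumrB 2!mulr_sumr -sumrB; apply: eq_bigr => j _.
rewrite -sumrB 2!mulr_sumr -sumrB; apply: eq_bigr => h _.
rewrite dotDl dotZl; ring.
Qed.

Lemma is_wls_scale (c : R) (wsd : R -> R) m (y : 'I_n -> 'I_m -> R) (b : 'cV[R]_p) :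
  is_wls f x wsd y b -> is_wls f x (fun t => c * wsd t) y b.
Proof.
move=> wls; rewrite /is_wls /= => b'; have := wls b' => /(ler_wpM2l (_ : 0 <= c ^- 2)).
rewrite invr_ge0 sqr_ge0 => /(_ isT); rewrite !mulr_sumr; congr (_ <= _).
  by apply: eq_bigr => j _; rewrite mulr_sumr; apply: eq_bigr => h _;
    rewrite exprMn [in RHS]invfM mulrA.
by apply: eq_bigr => j _; rewrite mulr_sumr; apply: eq_bigr => h _;
  rewrite exprMn [in RHS]invfM mulrA.
Qed.

Lemma regression_model_scale (sd wsd : R -> R) (c : R)
    d (Omega : measurableType d) (P : probability Omega R)
    (eps : obs_index n r -> {RV P >-> R}) (betahat : 'I_k -> Omega -> 'cV[R]_p) :
  regression_model f x beta sd wsd eps betahat ->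
  regression_model f x beta sd (fun t => c * wsd t) eps betahat.
Proof. by move=> [? ? wls]; split => // i w; exact: is_wls_scale. Qed.

Lemma information_scale (c : R) (sd : R -> R) :
  information f x (fun t => c * sd t) = c ^- 2 *: information f x sd.
Proof.
rewrite /information scaler_sumr; apply: eq_bigr => j _.
by rewrite scalerA exprMn invfM.
Qed.

Lemma Sigma_scale (c : R) (sd : R -> R) : c != 0 ->
  information f x sd \in unitmx ->
  Sigma f x (fun t => c * sd t) = c ^+ 2 *: Sigma f x sd.
Proof.
move=> c0 iu; rewrite /Sigma information_scale invmxZ ?invrK//.
by rewrite unitmxZ// unitfE invr_eq0 expf_neq0.
Qed.

Variables (sd : R -> R) (S : 'M[R]_p).
Hypothesis p0 : (0 < p)%N.
Hypothesis r0 : forall i, (0 < r i)%N.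
Hypothesis f0 : forall t, X t -> f t != 0.
Hypothesis Xx : forall j, X (x j).
Hypothesis sd0 : forall t, X t -> 0 < sd t.
Hypothesis info_unit : information f x sd \in unitmx.
Hypothesis SS : S^T *m S = Sigma f x sd.

(** An empty design would have information matrix 0, singular in positive dimension. *)
Lemma design_neq0 : X !=set0.
Proof.
case: n x Xx info_unit => [|n'] x' Xx' iu; last by exists (x' ord0).
exfalso; move: iu; rewrite /information big_ord0.
by case: p p0 => // p' _; rewrite unitmxE det0 unitr0.
Qed.

Lemma Sigma_root_unit : S \in unitmx.
Proof.
have : S^T *m S \in unitmx by rewrite SS unitmx_inv.
by rewrite unitmx_mul => /andP[].
Qed.

Lemma Sigma_root_neq0 t : X t -> S *m f t != 0.
Proof.
move=> Xt; apply: contra (f0 Xt) => /eqP h.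
by rewrite -[f t](mulKmx Sigma_root_unit) h mulmx0.
Qed.

Lemma Sigma_root_information : S *m information f x sd *m S^T = 1%:M.
Proof. by apply: mulmx1C; rewrite mulmxA SS mulVmx. Qed.

(** The vectors [S f(x j) / sd (x j)] form a Parseval frame. This solves the normal equations, makes
    the error coefficients orthonormal and recovers [xi] from the field. *)
Lemma Sigma_root_rows l l' :
  \sum_(j < n) sd (x j) ^- 2 * (S *m f (x j)) l 0 * (S *m f (x j)) l' 0 =
  (l == l')%:R.
Proof.
have := congr1 (fun M : 'M[R]_p => M l l') Sigma_root_information.
rewrite [RHS]mxE => <-.
rewrite /information mulmx_sumr mulmx_suml summxE; apply: eq_bigr => j _.
rewrite -mulrA -scalemxAr -scalemxAl [RHS]mxE; congr (_ * _).
have -> : S *m (f (x j) *m (f (x j))^T) *m S^T = (S *m f (x j)) *m (S *m f (x j))^T.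
  by rewrite trmx_mul !mulmxA.
by rewrite [RHS]mxE big_ord1 [X in _ = _ * X]mxE.
Qed.

Lemma quad_form_Sigma s2 u : quad_form (s2 *: Sigma f x sd) u = s2 * dot (S *m u) (S *m u).
Proof.
by rewrite /quad_form -SS -scalemxAr -scalemxAl mxE /dot trmx_mul !mulmxA.
Qed.

Lemma dot_Sigma_root u v : dot u v = dot (invmx S^T *m u) (S *m v).
Proof.
rewrite /dot trmx_mul trmx_inv trmxK mulmxA; congr (fun_of_matrix (_ *m _) 0 0).
by rewrite mulmxKV// Sigma_root_unit.
Qed.

Section standardized.
Context d (Omega : measurableType d) (P : probability Omega R)
  (eps : obs_index n r -> {RV P >-> R}) (betahat : 'I_k -> Omega -> 'cV[R]_p).
Hypothesis model : regression_model f x beta sd sd eps betahat.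

(** The normal equations make the minimizer an explicit linear function of the errors, from which
    both its measurability and its law follow. *)
Lemma standardized_estimator i w l :
  (invmx S^T *m (betahat i w - beta i)) l 0 =
  \sum_(j < n) \sum_(h < r i) (r i)%:R^-1 * sd (x j) ^- 2 *
    (S *m f (x j)) l 0 * eps (@obs_idx k n r i j h) w.
Proof.
have [_ _ /(_ i w) wls] := model.
pose z := invmx S^T *m (betahat i w - beta i).
(* Testing with the [l]-th row of [S] produces the [l]-th coordinates of the [S f(x j)]; the frame
   identity then isolates [z l 0]. *)
have := wls_normal_equation wls (row l S)^T.
have rowE j : dot (row l S)^T (f (x j)) = (S *m f (x j)) l 0.
  by rewrite dotE mxE; apply: eq_bigr => l' _; rewrite !mxE.
have ri0 : (r i)%:R != 0 :> R by rewrite pnatr_eq0 -lt0n.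
pose E := \sum_(j < n) \sum_(h < r i) sd (x j) ^- 2 *
  (S *m f (x j)) l 0 * eps (@obs_idx k n r i j h) w.
have -> : \sum_(j < n) \sum_(h < r i) (r i)%:R^-1 * sd (x j) ^- 2 *
    (S *m f (x j)) l 0 * eps (@obs_idx k n r i j h) w = (r i)%:R^-1 * E.
  rewrite /E mulr_sumr; apply: eq_bigr => j _; rewrite mulr_sumr.
  by apply: eq_bigr => h _; rewrite !mulrA.
have -> : \sum_(j < n) \sum_(h < r i) sd (x j) ^- 2 *
    (dot (beta i) (f (x j)) + eps (@obs_idx k n r i j h) w -
     dot (betahat i w) (f (x j))) * dot (row l S)^T (f (x j)) =
    E - (r i)%:R * z l 0.
  transitivity (E - (r i)%:R * \sum_(j < n) \sum_l' z l' 0 *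
      (sd (x j) ^- 2 * (S *m f (x j)) l' 0 * (S *m f (x j)) l 0)).
    rewrite /E mulr_sumr -sumrB; apply: eq_bigr => j _.
    have zE : dot (betahat i w - beta i) (f (x j)) = \sum_l' z l' 0 * (S *m f (x j)) l' 0.
      by rewrite dot_Sigma_root dotE.
    rewrite dotBl in zE.
    have -> : \sum_l' z l' 0 * (sd (x j) ^- 2 * (S *m f (x j)) l' 0 * (S *m f (x j)) l 0) =
        sd (x j) ^- 2 * (S *m f (x j)) l 0 *
        (dot (betahat i w) (f (x j)) - dot (beta i) (f (x j))).
      by rewrite zE mulr_sumr; apply: eq_bigr => l' _; ring.
    transitivity (\sum_(h < r i) (sd (x j) ^- 2 * (S *m f (x j)) l 0 *
        eps (@obs_idx k n r i j h) w - sd (x j) ^- 2 * (S *m f (x j)) l 0 *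
        (dot (betahat i w) (f (x j)) - dot (beta i) (f (x j))))).
      by apply: eq_bigr => h _; rewrite rowE; ring.
    by rewrite sumrB sumr_const card_ord mulr_natl.
  rewrite exchange_big /= (bigD1 l)//= [X in _ - _ * (_ + X)]big1 ?addr0.
    by rewrite -mulr_sumr Sigma_root_rows eqxx mulr1.
  by move=> l' /negbTE ll'; rewrite -mulr_sumr Sigma_root_rows ll' mulr0.
move=> /eqP; rewrite subr_eq0 => /eqP ->.
by rewrite mulKf.
Qed.

Variable C : 'I_k.-1 -> 'I_k -> R.
Hypothesis C_sum0 : forall a, \sum_i C a i = 0.
Hypothesis C_orth : forall a b, \sum_i C a i * C b i / (r i)%:R = (a == b)%:R.
Hypothesis C_span : forall c : 'I_k -> R, \sum_i c i = 0 ->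
  exists h : 'I_k.-1 -> R, forall i, c i = \sum_a h a * C a i.

Definition standardized_contrasts (w : Omega) (j : 'I_k.-1 * 'I_p) : R :=
  \sum_i C j.1 i * (invmx S^T *m (betahat i w - beta i)) j.2 0.

Definition error_coef (j : 'I_k.-1 * 'I_p) (o : obs_index n r) : R :=
  C j.1 (tag o) * ((r (tag o))%:R^-1 * sd (x (tagged o).1) ^- 2 *
    (S *m f (x (tagged o).1)) j.2 0).

Lemma sum_obs_index (F : obs_index n r -> R) :
  \sum_o F o = \sum_i \sum_(j < n) \sum_(h < r i) F (@obs_idx k n r i j h).
Proof.
transitivity (\sum_i \sum_(q : 'I_n * 'I_(r i)) F (Tagged (fun i => ('I_n * 'I_(r i))%type) q)).
  by rewrite sig_big_dep/=; apply: eq_bigr => -[].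
by apply: eq_bigr => i _; rewrite pair_bigA/=; apply: eq_bigr => -[].
Qed.

Lemma standardized_contrastsE w :
  standardized_contrasts w = linear_map error_coef (fun o => eps o w).
Proof.
apply/funext => j; rewrite /linear_map sum_obs_index; apply: eq_bigr => i _.
rewrite standardized_estimator mulr_sumr; apply: eq_bigr => j' _.
by rewrite mulr_sumr; apply: eq_bigr => h _; rewrite mulrA.
Qed.

(** The two factors [sd^-2] and the error variance leave one [sd^-2], as in the frame identity; the
    [r i] replicates turn [(r i)^-2] into [(r i)^-1], as in the orthonormality of [C]. *)
Lemma error_coef_orth j j' :
  \sum_o error_coef j o * error_coef j' o * sd (x (tagged o).1) ^+ 2 = (j == j')%:R.
Proof.
rewrite sum_obs_index /error_coef/=.
transitivity (\sum_i C j.1 i * C j'.1 i / (r i)%:R * (j.2 == j'.2)%:R).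
  apply: eq_bigr => i _; rewrite -Sigma_root_rows mulr_sumr; apply: eq_bigr => l _.
  rewrite sumr_const card_ord.
  have ri0 : (r i)%:R != 0 :> R by rewrite pnatr_eq0 -lt0n.
  have s0 : sd (x l) != 0 by rewrite gt_eqF// sd0.
  by field; rewrite s0 ri0.
by rewrite -mulr_suml C_orth -natrM mulnb -xpair_eqE -!surjective_pairing.
Qed.

Lemma contrast_norm (c : 'I_k -> R) (h : 'I_k.-1 -> R) :
  (forall i, c i = \sum_a h a * C a i) ->
  \sum_i c i ^+ 2 / (r i)%:R = dot (\col_a h a) (\col_a h a).
Proof.
move=> ch; rewrite dotE.
transitivity (\sum_i \sum_a h a * (\sum_b h b * (C a i * C b i / (r i)%:R))).
  apply: eq_bigr => i _; rewrite expr2 {1}ch !mulr_suml; apply: eq_bigr => a _.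
  rewrite -!mulrA; congr (_ * _); rewrite ch mulr_suml mulr_sumr.
  by apply: eq_bigr => b _; rewrite -!mulrA; rewrite mulrCA.
rewrite exchange_big/=; apply: eq_bigr => a _; rewrite -mulr_sumr !mxE; congr (_ * _).
rewrite exchange_big/= (bigD1 a)//= [X in _ + X]big1 ?addr0.
  by rewrite -mulr_sumr C_orth eqxx mulr1.
by move=> b /negbTE ba; rewrite -mulr_sumr C_orth eq_sym ba mulr0.
Qed.

Lemma contrast_deviation (c : 'I_k -> R) (h : 'I_k.-1 -> R) w t : X t ->
  (forall i, c i = \sum_a h a * C a i) ->
  \sum_i c i * dot (betahat i w) (f t) - \sum_i c i * dot (beta i) (f t) =
  l2norm (S *m f t) *
    \sum_j field_coef f S t (\col_a h a) j * standardized_contrasts w j.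
Proof.
move=> Xt ch; have Sf := l2norm_gt0 (Sigma_root_neq0 Xt).
rewrite -sumrB field_coef_sum dotE mulr_sumr.
transitivity (\sum_i \sum_a h a * (C a i *
    dot (invmx S^T *m (betahat i w - beta i)) (S *m f t))).
  apply: eq_bigr => i _; rewrite -mulrBr -dotBl dot_Sigma_root ch mulr_suml.
  by apply: eq_bigr => a _; rewrite mulrA.
rewrite exchange_big/=; apply: eq_bigr => a _.
rewrite -mulr_sumr [(\col_i h i) _ _]mxE mulrCA; congr (_ * _).
rewrite [X in _ = _ * X]mxE mulr_sumr.
transitivity (\sum_i \sum_l C a i * ((invmx S^T *m (betahat i w - beta i)) l 0 *
    (S *m f t) l 0)).
  by apply: eq_bigr => i _; rewrite dotE mulr_sumr.
rewrite exchange_big/=; apply: eq_bigr => l _.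
rewrite [psi _ _ _ _ _]mxE [RHS]mulrCA mulVKf ?gt_eqF// mulr_suml.
by apply: eq_bigr => i _; rewrite mulrA.
Qed.

(** Both sides of a band statement carry the norms of [S *m f t] and of the coefficient vector [h];
    dividing them out leaves unit vectors. The absolute value is recovered because [- h] is a unit
    vector as well. *)
Lemma in_band_standardized w s2 b : (1 < k)%N ->
  in_band r X f beta (fun i => betahat i w) (s2 *: Sigma f x sd) b <->
  field_norm X f S (standardized_contrasts w) <= b * Num.sqrt s2.
Proof.
move=> k1; have m0 : (0 < k.-1)%N by case: k k1 => [|[]].
have bandE (c : 'cV[R]_k) (h : 'I_k.-1 -> R) t : X t -> (forall i, c i 0 = \sum_a h a * C a i) ->
    (`|\sum_(i < k) c i 0 * dot (betahat i w) (f t) -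
       \sum_(i < k) c i 0 * dot (beta i) (f t)| <=
     b * Num.sqrt ((\sum_(i < k) c i 0 ^+ 2 / (r i)%:R) *
       quad_form (s2 *: Sigma f x sd) (f t))) =
    (`|\sum_j field_coef f S t (\col_a h a) j * standardized_contrasts w j| <=
     b * Num.sqrt s2 * l2norm (\col_a h a)).
  move=> Xt ch; have Sf := l2norm_gt0 (Sigma_root_neq0 Xt).
  rewrite (contrast_deviation w Xt ch) (contrast_norm ch) quad_form_Sigma.
  have -> : Num.sqrt (dot (\col_a h a) (\col_a h a) *
      (s2 * dot (S *m f t) (S *m f t))) =
      l2norm (\col_a h a) * Num.sqrt s2 * l2norm (S *m f t).
    (* Only the factors known to be nonnegative are split off, so [s2] may have any sign, with root
       0 if negative; the equivalence thus covers every value of the variance estimate. *)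
    rewrite mulrCA mulrC sqrtrM ?mulr_ge0 ?dot_ge0// sqrtrM ?dot_ge0//.
    by rewrite -!/(l2norm _) mulrAC.
  rewrite normrM (gtr0_norm Sf) -[RHS](ler_pM2l Sf); congr (_ <= _); ring.
have X0 := design_neq0.
have normP := field_norm_leP m0 X0 Sigma_root_neq0.
split=> [band|/normP hN t c Xt [c0 cs]].
  apply/normP => t h Xt h1; apply: le_trans (ler_norm _) _.
  have hE : \col_a h a 0 = h by apply/matrixP => i j; rewrite mxE ord1.
  pose c : 'cV[R]_k := \col_i \sum_a h a 0 * C a i.
  have cE i : c i 0 = \sum_a h a 0 * C a i by rewrite mxE.
  have c_contrast : contrasts c.
    split.
      (* A unit [h] cannot give [c = 0], as [contrast_norm] would then read [0 = 1]. *)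
      apply/eqP => c0; have := contrast_norm cE; rewrite hE (unit_sphere_dot h1).
      rewrite big1; first by move/eqP; rewrite eq_sym oner_eq0.
      move=> i _; have -> : c i 0 = 0.
        exact: (congr1 (fun g : 'I_k -> 'I_1 -> R => g i 0) c0).
      by rewrite expr0n mul0r.
    under eq_bigr do rewrite cE.
    by rewrite exchange_big/= big1// => a _; rewrite -mulr_sumr C_sum0 mulr0.
  by have := band t c Xt c_contrast; rewrite (bandE c _ t Xt cE) hE h1 mulr1.
have [h ch] := C_span cs.
rewrite (bandE c _ t Xt ch); set hv := \col_a h a.
have hv0 : hv != 0.
  apply/eqP => hv0; move/eqP: c0; apply; apply/funext => i; apply/funext => j.
  rewrite (ord1 j) ch big1// => a _.
  by have := congr1 (fun M : 'cV[R]_k.-1 => M a 0) hv0; rewrite !mxE => ->; rewrite mul0r.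
have hvn := l2norm_gt0 hv0.
have u1 := l2norm_normalize hv0.
have h1 := hN t _ Xt u1; have h2 := hN t _ Xt (unit_sphereN u1).
rewrite !field_coef_sum in h1 h2 *.
have z0 : 0 < (l2norm hv)^-1 by rewrite invr_gt0.
rewrite -ler_pdivrMr// mulrC -(gtr0_norm z0) -normrM -dotZl ler_norml h1 andbT lerNl.
by rewrite dotNl in h2.
Qed.

End standardized.
End weighted_least_squares.

(** * Joint laws *)

Section laws_of_random_vectors.
Context d (Omega : measurableType d) (R : realType) (P : probability Omega R).

Definition random_vector (I : finType) (V : I -> {RV P >-> R}) (w : Omega) :
  product_space R I := fun i => V i w.

Lemma measurable_random_vector (I : finType) (V : I -> {RV P >-> R}) :
  measurable_fun setT (random_vector V).
Proof. by apply: measurable_to_product => i; exact: measurable_funP. Qed.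

HB.instance Definition _ (I : finType) (V : I -> {RV P >-> R}) :=
  isMeasurableFun.Build _ _ _ _ (random_vector V) (measurable_random_vector V).

Lemma sigma_rv_preimage (W : Omega -> R) B : measurable B -> sigma_rv W (W @^-1` B).
Proof. by move=> mB; exists B => //; rewrite setTI. Qed.

(** The sample space with the sigma-algebra generated by the family, so that membership in
    [sigma_family] is proved by composing measurable functions. *)
Definition family_space (I : Type) (D : set I) (W : I -> Omega -> R) : Type :=
  g_sigma_algebraType (\bigcup_(i in D) sigma_rv (W i)).

HB.instance Definition _ (I : Type) (D : set I) (W : I -> Omega -> R) :=
  Measurable.on (family_space D W).

Lemma measurable_family_member (I : Type) (D : set I) (W : I -> Omega -> R) i :
  D i -> measurable_fun setT (W i : family_space D W -> R).
Proof.
move=> Di _ B mB; rewrite setTI; apply: sub_sigma_algebra; exists i => //.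
exact: sigma_rv_preimage.
Qed.

Lemma sigma_family_preimage (I : Type) (D : set I) (W : I -> Omega -> R)
    (U : Omega -> R) B :
  measurable_fun setT (U : family_space D W -> R) -> measurable B ->
  sigma_family D W (U @^-1` B).
Proof. by move=> mU mB; have := mU measurableT _ mB; rewrite setTI. Qed.

Lemma gaussian_random_vector (I : finType) (s : I -> R) (V : I -> {RV P >-> R}) :
  mutually_independent P (fun i => sigma_rv (V i)) ->
  (forall i, has_law P (V i) (normal_prob 0 (s i))) ->
  gaussian_law s (distribution P (random_vector V)).
Proof.
move=> indV lawV A mA.
rewrite /distribution /pushforward/=.
have -> : random_vector V @^-1` [set x | forall i, A i (x i)] =
    \bigcap_i (V i @^-1` A i).
  apply/seteqP; split => w /= h i; [move=> _; exact: (h i)|exact: (h i Logic.I)].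
rewrite indV; last by move=> i; exact: sigma_rv_preimage.
by apply: eq_bigr => i _; exact: lawV.
Qed.

Lemma gaussian_iid_vectors m q (xi : 'I_m -> 'I_q -> {RV P >-> R}) :
  iid_std_normal_vectors xi ->
  gaussian_law (fun=> 1)
    (distribution P (random_vector (fun j : 'I_m * 'I_q => xi j.1 j.2))).
Proof.
move=> [ind_rows rows] A mA.
rewrite /distribution /pushforward/=.
pose B i := \bigcap_(l in [set: 'I_q]) (xi i l @^-1` A (i, l)).
have -> : random_vector (fun j : 'I_m * 'I_q => xi j.1 j.2) @^-1`
    [set x | forall i, A i (x i)] = \bigcap_i B i.
  apply/seteqP; split => w /= h.
    by move=> i _ l _; exact: (h (i, l)).
  by move=> [i l]; exact: (h i Logic.I l Logic.I).
rewrite ind_rows; last first.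
  move=> i; rewrite /B.
  have mB : measurable (\bigcap_(l in [set: 'I_q]) (xi i l @^-1` A (i, l)) :
      set (family_space setT (fun l => xi i l : Omega -> R))).
    apply: fin_bigcap_measurable; first exact: finite_finset.
    move=> l _; rewrite -[X in measurable X]setTI.
    exact: (@measurable_family_member _ setT (fun l => xi i l : Omega -> R) l Logic.I).
  exact: mB.
transitivity (\prod_i \prod_l normal_prob 0 1 (A (i, l)))%E.
  apply: eq_bigr => i _; have [ind_coords laws] := rows i.
  rewrite /B ind_coords; last by move=> l; exact: sigma_rv_preimage.
  by apply: eq_bigr => l _; exact: laws.
by rewrite pair_bigA; apply: eq_bigr => -[].
Qed.

Lemma joint_law (T U : {RV P >-> R}) (kap mu : probability R R) :
  (forall A B, measurable A -> measurable B ->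
    P (T @^-1` A `&` U @^-1` B) = (kap A * mu B)%E) ->
  forall E, measurable E -> P [set w | E (T w, U w)] = (kap \x mu)%E E.
Proof.
move=> TU E mE.
have mTU : measurable_fun setT (fun w => (T w, U w)) by exact: measurable_fun_pair.
pose TUrv : {RV P >-> (R * R)%type} :=
  HB.pack (fun w => (T w, U w)) (isMeasurableFun.Build _ _ _ _ _ mTU).
by apply/esym; apply: (@product_measure_unique _ _ _ _ _ kap mu (distribution P TUrv)).
Qed.

End laws_of_random_vectors.

(** * The common law of the pivot and of the field maximum, and independence of the scale *)

(** [mu] is a mere set function, so [chi2_prob] serves as a common reference without being shown to
    be a measure. *)
Lemma has_law_scaled d d' (Omega : measurableType d) (Omega' : measurableType d')
    (R : realType) (P : probability Omega R) (P' : probability Omega' R)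
    (W : Omega -> R) (W' : Omega' -> R) (c : R) (mu : set R -> \bar R) :
  c != 0 -> has_law P (fun w => c * W w) mu -> has_law P' (fun w => c * W' w) mu ->
  forall A, measurable A -> P (W @^-1` A) = P' (W' @^-1` A).
Proof.
move=> c0 lW lW' A mA.
pose B := (fun t : R => c^-1 * t) @^-1` A.
have mc : measurable_fun setT (fun t : R => c^-1 * t) by exact: measurable_funM.
have mB : measurable B by rewrite -[X in measurable X]setTI; exact: mc.
have BE (V : R) : B (c * V) = A V by rewrite /B /= mulKf.
have := lW _ mB; rewrite -(lW' _ mB).
have -> : (fun w => c * W w) @^-1` B = W @^-1` A by apply/seteqP; split => w /=; rewrite BE.
by have -> : (fun w => c * W' w) @^-1` B = W' @^-1` A by apply/seteqP; split => w /=; rewrite BE.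
Qed.

Lemma chi2_prob_le0 (R : realType) (nu : nat) : chi2_prob nu `]-oo, 0 : R]%classic = 0%E.
Proof.
rewrite /chi2_prob integral0_eq// => t /=; rewrite in_itv/= => t0.
by rewrite /chi2_pdf ltNge t0.
Qed.

(** The law of [xi], given by hypothesis, serves as the reference standard Gaussian law, and [mu] is
    the law of the seminorm under it; only the estimator side has to be matched to it. *)
Lemma pivot_law (R : realType) (k p n : nat) (r : 'I_k -> nat) (X : set R)
    (f : R -> 'cV[R]_p) (x : 'I_n -> R) (beta : 'I_k -> 'cV[R]_p)
    (sd : R -> R) (S : 'M[R]_p) (C : 'I_k.-1 -> 'I_k -> R)
    d (Omega : measurableType d) (P : probability Omega R)
    (eps : obs_index n r -> {RV P >-> R}) (betahat : 'I_k -> Omega -> 'cV[R]_p)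
    d' (Omega' : measurableType d') (P' : probability Omega' R)
    (xi : 'I_k.-1 -> 'I_p -> {RV P' >-> R}) :
  (1 < k)%N -> (0 < p)%N -> (forall i, (0 < r i)%N) ->
  (forall t, X t -> f t != 0) -> (forall j, X (x j)) ->
  (forall t, X t -> 0 < sd t) -> information f x sd \in unitmx ->
  S^T *m S = Sigma f x sd -> regression_model f x beta sd sd eps betahat ->
  (forall a b, \sum_i C a i * C b i / (r i)%:R = (a == b)%:R) ->
  iid_std_normal_vectors xi ->
  exists (U : {RV P >-> R}) (U' : {RV P' >-> R}) (mu : probability R R),
  [/\ forall w, U w = field_norm X f S (standardized_contrasts beta S betahat C w),
      forall w, U' w = field_norm X f S (fun j => xi j.1 j.2 w),
      continuous_positive_law mu,
      forall B, measurable B -> P (U @^-1` B) = mu B &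
      forall B, measurable B -> P' (U' @^-1` B) = mu B].
Proof.
move=> k1 p0 r0 f0 Xx sd0 iu SS model C_orth iid.
have m0 : (0 < k.-1)%N by case: k k1 {r beta eps betahat xi model C_orth iid C r0} => [|[]].
have X0 := design_neq0 p0 Xx iu.
have Sf0 := Sigma_root_neq0 f0 iu SS.
have sN := field_norm_seminorm m0 X0 Sf0.
have N0 := field_norm_neq0 m0 X0 Sf0.
have mN := measurable_seminorm sN.
have ggam := gaussian_iid_vectors iid.
set V := random_vector _ in ggam; set gam := distribution P' _ in ggam.
pose Nrv : {RV gam >-> R} :=
  HB.pack (field_norm X f S : product_space R _ -> R) (isMeasurableFun.Build _ _ _ _ _ mN).
have [indep laws _] := model.
have geps : gaussian_law (fun o : obs_index n r => sd (x (tagged o).1))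
    (distribution P (random_vector eps)).
  by apply: gaussian_random_vector => // -[i [j h]]; exact: laws.
have sneq0 (o : obs_index n r) : sd (x (tagged o).1) != 0 by rewrite gt_eqF// sd0.
have mU : measurable_fun setT (fun w => field_norm X f S
    (standardized_contrasts beta S betahat C w)).
  have -> : (fun w => field_norm X f S (standardized_contrasts beta S betahat C w)) =
      (field_norm X f S : product_space R _ -> R) \o
      (linear_map (error_coef f x sd S C) \o random_vector eps).
    by apply/funext => w /=; rewrite (standardized_contrastsE r0 iu SS model).
  exact: measurableT_comp.
have mU' : measurable_fun setT (fun w => field_norm X f S (fun j => xi j.1 j.2 w)).
  exact: (measurableT_comp mN (measurable_random_vector (fun j => xi j.1 j.2))).
pose U : {RV P >-> R} := HB.pack (fun w => field_norm X f S
  (standardized_contrasts beta S betahat C w)) (isMeasurableFun.Build _ _ _ _ _ mU).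
pose U' : {RV P' >-> R} := HB.pack
  (fun w => field_norm X f S (fun j => xi j.1 j.2 w)) (isMeasurableFun.Build _ _ _ _ _ mU').
exists U, U', (distribution gam Nrv); split => //.
- split.
  + by move=> b; exact: (seminorm_atomless sN ggam N0).
  + by move=> a b ab; exact: (seminorm_itv_gt0 sN ggam N0).
  + exact: (seminorm_le0_null sN ggam N0).
- move=> B mB.
  rewrite -[RHS](gaussian_linear_map sneq0 geps ggam
    (error_coef_orth r0 Xx sd0 iu SS C_orth)); last exact: measurable_seminorm_preimage.
  congr (P _); apply/seteqP; split => w /=;
    by rewrite (standardized_contrastsE r0 iu SS model).
Qed.

Lemma measurable_field_norm_estimator (R : realType) (k p n : nat) (X : set R)
    (f : R -> 'cV[R]_p) (beta : 'I_k -> 'cV[R]_p) (S : 'M[R]_p)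
    (C : 'I_k.-1 -> 'I_k -> R) d (Omega : measurableType d)
    (betahat : 'I_k -> Omega -> 'cV[R]_p) :
  (0 < k.-1)%N -> X !=set0 -> (forall t, X t -> S *m f t != 0) ->
  measurable_fun setT
    ((fun w => field_norm X f S (standardized_contrasts beta S betahat C w)) :
      family_space setT (fun (il : 'I_k * 'I_p) w => betahat il.1 w il.2 0) -> R).
Proof.
move=> m0 X0 Sf0.
have mN := measurable_seminorm (field_norm_seminorm m0 X0 Sf0).
apply: (measurableT_comp mN); apply: measurable_to_product => -[a l].
apply: measurable_sum => i; apply: measurable_funM => //=.
have -> : (fun w => (invmx S^T *m (betahat i w - beta i)) l 0) =
    (fun w => \sum_l' invmx S^T l l' * (betahat i w l' 0 - beta i l' 0)).
  apply/funext => w; rewrite mxE; apply: eq_bigr => l' _.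
  by congr (_ * _); rewrite !mxE.
apply: measurable_sum => l'; apply: measurable_funM => //=.
apply: measurable_funB => //.
exact: (@measurable_family_member _ _ _ _ setT
  (fun (il : 'I_k * 'I_p) w => betahat il.1 w il.2 0) (i, l') Logic.I).
Qed.

(** [tau2] is assumed independent of the field, not of [xi]. But the field determines [xi]: by the
    frame identity each [xi i l] is a linear combination of the values of [Z] at the design points
    in the [i]-th basis direction. *)
Lemma measurable_field_norm_Z (R : realType) (m p n : nat) (X : set R)
    (f : R -> 'cV[R]_p) (x : 'I_n -> R) (sd : R -> R) (S : 'M[R]_p)
    d (Omega : measurableType d) (xi : 'I_m -> 'I_p -> Omega -> R) :
  (0 < m)%N -> X !=set0 -> (forall t, X t -> S *m f t != 0) ->
  (forall j, X (x j)) -> information f x sd \in unitmx ->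
  S^T *m S = Sigma f x sd ->
  measurable_fun setT ((fun w => field_norm X f S (fun j => xi j.1 j.2 w)) :
    family_space (X `*` @unit_sphere R m) (fun th => Zfield f S xi th.1 th.2) -> R).
Proof.
move=> m0 X0 Sf0 Xx iu SS.
have mN := measurable_seminorm (field_norm_seminorm m0 X0 Sf0).
apply: (measurableT_comp mN); apply: measurable_to_product => -[i l].
have xiE w : xi i l w = \sum_(j < n) sd (x j) ^- 2 * (S *m f (x j)) l 0 *
    l2norm (S *m f (x j)) * Zfield f S xi (x j) (delta_mx i 0) w.
  transitivity (\sum_(l' < p) xi i l' w * (l == l')%:R).
    rewrite (bigD1 l)//= eqxx mulr1 big1 ?addr0// => l' /negbTE ll'.
    by rewrite eq_sym ll' mulr0.
  under eq_bigr do rewrite -(Sigma_root_rows iu SS) mulr_sumr.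
  rewrite exchange_big/=; apply: eq_bigr => j _.
  rewrite ZfieldE field_coef_sum dotE (bigD1 i)//= [X in _ + X]big1 ?addr0; last first.
    by move=> i' /negbTE ii'; rewrite [delta_mx _ _ _ _]mxE ii' mul0r.
  rewrite [delta_mx _ _ _ _]mxE !eqxx mul1r mxE !mulr_sumr; apply: eq_bigr => l' _.
  rewrite [psi _ _ _ _ _]mxE; have Sf := l2norm_gt0 (Sf0 _ (Xx j)).
  by move: (sd (x j) ^- 2) => c; field; rewrite gt_eqF.
rewrite (_ : (fun w => _) = (fun w => \sum_(j < n) sd (x j) ^- 2 * (S *m f (x j)) l 0 *
    l2norm (S *m f (x j)) * Zfield f S xi (x j) (delta_mx i 0) w)); last first.
  by apply/funext => w; rewrite /= xiE.
apply: measurable_sum => j; apply: measurable_funM => //.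
apply: (@measurable_family_member _ _ _ _ (X `*` @unit_sphere R m)
  (fun th => Zfield f S xi th.1 th.2) (x j, delta_mx i 0)).
by split => //=; exact: delta_unit.
Qed.

(** * Critical values for known and for estimated variance *)

Theorem theorem2p1 (R : realType) (k p n : nat) (r : 'I_k -> nat)
  (X : set R) (f : R -> 'cV[R]_p) (x : 'I_n -> R) (beta : 'I_k -> 'cV[R]_p)
  (* the model: errors and weighted least squares estimators *)
  (d : measure_display) (Omega : measurableType d) (P : probability Omega R)
  (eps : obs_index n r -> {RV P >-> R})
  (betahat : 'I_k -> Omega -> 'cV[R]_p)
  (* the auxiliary i.i.d. standard normal vectors defining Z and Y *)
  (d' : measure_display) (Omega' : measurableType d')
  (P' : probability Omega' R)
  (xi : 'I_k.-1 -> 'I_p -> {RV P' >-> R})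
  (alpha : R) :
  (3 <= k)%N -> (0 < p)%N -> (forall i, 0 < r i)%N ->
  finite_union_itv X -> (forall t, X t -> f t != 0) -> (forall j, X (x j)) ->
  iid_std_normal_vectors xi ->
  0 < alpha < 1 ->
  (* (1) Sigma known *)
  (forall (sd : R -> R) (S : 'M[R]_p),
    (forall t, X t -> 0 < sd t) ->
    information f x sd \in unitmx ->
    regression_model f x beta sd sd eps betahat ->
    S^T *m S = Sigma f x sd ->
    let critical := is_critical_value
      (coverage r X f beta P betahat (fun=> Sigma f x sd)) alpha in
    let pZ b := P' [set w | (b%:E <= maxZ X f S xi w)%E] in
    let pY b := P' [set w | ((b ^+ 2)%:E <= maxY X f S xi w)%E] in
    [/\ exists! b, critical b,
        forall b, 0 <= b -> pZ b = pY b &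
        forall b, critical b <-> pZ b = pY b /\ pY b = alpha%:E]) /\
  (* (2) Sigma = sigma^2 Sigma_0 with sigma^2 unknown *)
  (forall (sd0 : R -> R) (sigma : R) (S : 'M[R]_p) (nu : nat)
      (sigma2hat : {RV P >-> R}) (tau2 : {RV P' >-> R}),
    (forall t, X t -> 0 < sd0 t) -> 0 < sigma -> (0 < nu)%N ->
    information f x sd0 \in unitmx ->
    regression_model f x beta (fun t => sigma * sd0 t) sd0 eps betahat ->
    S^T *m S = sigma ^+ 2 *: Sigma f x sd0 ->
    has_law P (fun w => nu%:R * sigma2hat w / sigma ^+ 2) (chi2_prob nu) ->
    independent P (sigma_rv sigma2hat)
      (sigma_family setT
         (fun (il : 'I_k * 'I_p) (w : Omega) => betahat il.1 w il.2 0)) ->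
    has_law P' (fun w => nu%:R * tau2 w) (chi2_prob nu) ->
    independent P' (sigma_rv tau2)
      (sigma_family (X `*` @unit_sphere R k.-1)
         (fun th => Zfield f S xi th.1 th.2)) ->
    independent P' (sigma_rv tau2) (sigma_family X (Yproc f S xi)) ->
    let critical := is_critical_value
      (coverage r X f beta P betahat
         (fun w => sigma2hat w *: Sigma f x sd0)) alpha in
    let pZ b := 'E_P'[cond_prob P'
      [set w | ((b * Num.sqrt (tau2 w))%:E <= maxZ X f S xi w)%E] tau2]%E in
    let pY b := 'E_P'[cond_prob P'
      [set w | ((b ^+ 2 * tau2 w)%:E <= maxY X f S xi w)%E] tau2]%E in
    [/\ exists! b, critical b,
        forall b, 0 <= b -> pZ b = pY b &
        forall b, critical b <-> pZ b = pY b /\ pY b = alpha%:E]).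
Proof.
move=> k3 p0 r0 _ f0 Xx iid a01.
have k1 : (1 < k)%N by exact: ltn_trans k3.
have m0 : (0 < k.-1)%N by case: (k) k1 => [|[]].
have [C [C0 C_orth C_span]] := contrast_basis (R := R) (ltnW k1) r0.
split.
- move=> sd S sd0 iu model SS.
  have X0 := design_neq0 p0 Xx iu; have Sf0 := Sigma_root_neq0 f0 iu SS.
  have [U [U' [mu [UE U'E muP lawU lawU']]]] :=
    pivot_law k1 p0 r0 f0 Xx sd0 iu SS model C_orth iid.
  have sN := field_norm_seminorm m0 X0 Sf0.
  apply: (critical_value_characterization muP a01) => b.
  + rewrite /coverage -lawU//; congr (P _); apply/seteqP.
    (* Known variance is the case [s2 = 1]. *)
    have band w := in_band_standardized (C := C) beta p0 f0 Xx iu SS betahat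
      C0 C_orth C_span w 1 b k1.
    split => w /=; rewrite in_itv/= UE.
      by move=> h; rewrite -[b]mulr1 -sqrtr1; apply/band; rewrite scale1r.
    by move=> h; rewrite -[Sigma f x sd]scale1r; apply/band; rewrite sqrtr1 mulr1.
  + rewrite -lawU'//; congr (P' _); apply/seteqP.
    by split => w /=; rewrite in_itv/= andbT U'E (maxZE m0 X0 Sf0) lee_fin.
  + move=> b0; congr (P' _); apply/seteqP.
    by split => w /=; rewrite (maxZE m0 X0 Sf0) (maxYE m0 X0 Sf0) !lee_fin
      ler_pXn2r ?nnegrE// (seminorm_ge0 sN).
- move=> sd0 sigma S nu sigma2hat tau2 sd0_gt0 sigma0 nu0 iu0 model0 SS0.
  move=> law_s ind_s law_t ind_t _.
  (* Rescaling all weights does not move the minimizer, so the weights may use the true deviation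
     [sd]; what remains random is the scale [T], the ratio of [sigma2hat] to [sigma ^+ 2]. *)
  pose sd t := sigma * sd0 t.
  have sn0 : sigma != 0 by rewrite gt_eqF.
  have sd_gt0 t : X t -> 0 < sd t by move=> Xt; rewrite mulr_gt0// sd0_gt0.
  have SigmaE := Sigma_scale sn0 iu0.
  have iu : information f x sd \in unitmx.
    by rewrite information_scale unitmxZ// unitfE invr_eq0 expf_neq0.
  have SS : S^T *m S = Sigma f x sd by rewrite SS0 -SigmaE.
  have model : regression_model f x beta sd sd eps betahat.
    exact: regression_model_scale model0.
  have X0 := design_neq0 p0 Xx iu; have Sf0 := Sigma_root_neq0 f0 iu SS.
  have [U [U' [mu [UE U'E muP lawU lawU']]]] :=
    pivot_law k1 p0 r0 f0 Xx sd_gt0 iu SS model C_orth iid.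
  have sN := field_norm_seminorm m0 X0 Sf0.
  have nu_neq0 : nu%:R != 0 :> R by rewrite pnatr_eq0 -lt0n.
  pose kap : probability R R := distribution P' tau2.
  have mT : measurable_fun setT (fun w => sigma2hat w / sigma ^+ 2).
    exact: measurable_funM.
  pose T : {RV P >-> R} := HB.pack (fun w => sigma2hat w / sigma ^+ 2)
    (isMeasurableFun.Build _ _ _ _ _ mT).
  have lawT A : measurable A -> P (T @^-1` A) = kap A.
    apply: has_law_scaled nu_neq0 _ law_t A => B mB; rewrite -law_s//.
    by congr (P _); apply/seteqP; split => w /=; rewrite mulrA.
  have kap0 : kap `]-oo, 0]%classic = 0%E.
    rewrite -(chi2_prob_le0 R nu) -law_t//; congr (P' _); apply/seteqP.
    by split => w /=; rewrite !in_itv/= pmulr_rle0// ltr0n.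
  have joint A B : measurable A -> measurable B ->
      P (T @^-1` A `&` U @^-1` B) = (kap A * mu B)%E.
    move=> mA mB; rewrite -lawT// -lawU//; apply: ind_s.
      have mdiv : measurable_fun setT (fun t : R => t / sigma ^+ 2).
        exact: measurable_funM.
      exists ((fun t => t / sigma ^+ 2) @^-1` A); last by rewrite setTI.
      by rewrite -[X in measurable X]setTI; exact: mdiv.
    have -> : U @^-1` B = (fun w => field_norm X f S
        (standardized_contrasts beta S betahat C w)) @^-1` B.
      by apply/seteqP; split => w /=; rewrite UE.
    apply: sigma_family_preimage mB.
    exact: measurable_field_norm_estimator.
  have joint' A B : measurable A -> measurable B ->
      P' (tau2 @^-1` A `&` U' @^-1` B) = (kap A * mu B)%E.
    move=> mA mB; rewrite -[kap A]/(P' (tau2 @^-1` A)) -lawU'//; apply: ind_t.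
      exact: sigma_rv_preimage.
    have -> : U' @^-1` B = (fun w => field_norm X f S (fun j => xi j.1 j.2 w)) @^-1` B.
      by apply/seteqP; split => w /=; rewrite U'E.
    apply: sigma_family_preimage mB.
    exact: measurable_field_norm_Z iu SS.
  have [rho [rhoP rho_le rho_ge]] := ratio_law kap0 muP.
  have eventE b : [set w | ((b * Num.sqrt (tau2 w))%:E <= maxZ X f S xi w)%E] =
      [set w | b * Num.sqrt (tau2 w) <= U' w].
    by apply/seteqP; split => w /=; rewrite U'E (maxZE m0 X0 Sf0) lee_fin.
  apply: (critical_value_characterization rhoP a01) => b.
  + rewrite -rho_le -(joint_law joint (measurable_le_sqrt b)) /coverage.
    congr (P _); apply/seteqP.
    have band w := in_band_standardized (C := C) beta p0 f0 Xx iu SS betahat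
      C0 C_orth C_span w (T w) b k1.
    have VE w : T w *: Sigma f x sd = sigma2hat w *: Sigma f x sd0.
      by rewrite SigmaE scalerA divfK// expf_neq0.
    split => w /=; rewrite UE.
      by move=> h; apply/band; rewrite VE.
    by move=> /band; rewrite VE.
  + rewrite eventE -rho_ge -(joint_law joint' (measurable_ge_sqrt b)).
    apply: expectation_cond_prob.
    have mTU : measurable_fun setT (fun w => (tau2 w, U' w)) by exact: measurable_fun_pair.
    have := mTU measurableT _ (measurable_ge_sqrt b).
    by rewrite setTI.
  + move=> b0.
    have -> : [set w | ((b * Num.sqrt (tau2 w))%:E <= maxZ X f S xi w)%E] =
        [set w | ((b ^+ 2 * tau2 w)%:E <= maxY X f S xi w)%E].
      apply/funext => w /=; congr is_true.
      rewrite (maxZE m0 X0 Sf0) (maxYE m0 X0 Sf0) !lee_fin.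
      have N0 := seminorm_ge0 sN (fun j => xi j.1 j.2 w).
      (* Where [tau2] is negative its square root is 0 and both events hold, so the events coincide
         everywhere and not just almost surely. *)
      have [t0|/ltW t0] := leP 0 (tau2 w).
        rewrite -[in RHS](sqr_sqrtr t0) -exprMn ler_pXn2r ?nnegrE//.
        by rewrite mulr_ge0 ?sqrtr_ge0.
      rewrite ler0_sqrtr// mulr0 N0; apply/esym.
      by apply: le_trans (sqr_ge0 _); rewrite mulr_ge0_le0 ?sqr_ge0.
    by [].
Qed.
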